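(* Consider fractional split trees with parameters $b,s,s_0,s_1$ and split vector $\mathcal V$, and assume that $V$ is $B(a,s_0+(b-1)s_1)$ Beta-distributed for some $a>0$. (Because $\mathbb E[V]\le\frac1b$, it must hold that $a\le\frac{s_0}{b-1}+s_1$, with equality if and only if $\beta=1$.) Then $$\mu=\psi\bigl(a+\beta+s_0+(b-1)s_1\bigr)-\psi(a+\beta),$$ where $\psi(t)=\Gamma'(t)/\Gamma(t)$ is the digamma function, and $$\varpi[\delta_k]=\frac{\Gamma(a+k-s_1)}{\mu\,\Gamma(a+k-s_1+\beta+1)}$$ for every integer $k\ge1$ such that either $k>s$, or ($s\le s_0+bs_1$ and $k>s_1$).
   Context: Fractional split trees. Fix integers $b\ge2$, $s\ge1$, $s_0\ge0$, $s_1\ge0$ with $0\le bs_1\le s+1-s_0$, and a random vector $\mathcal V=(V_1,\dots,V_b)$ (the split vector) with $V_i\ge0$ and $\sum_{i=1}^bV_i\le1$; if $\sum_iV_i=1$ a.s. the model is called a split tree. Let $V_{(1)}\ge\dots\ge V_{(b)}$ be the entries of $\mathcal V$ in decreasing order. Standing assumptions: $\mathbb P(V_{(1)}=1)<1$, $\mathbb P(V_{(b)}>0)>0$ and $\sum_{i=1}^b\mathbb P(V_i>0)>1$. Nodes are the finite words over $[b]=\{1,\dots,b\}$, i.e. elements of $[b]^*=\bigcup_{m\ge0}[b]^m$; the root is the empty word and the children of $v$ are $v1,\dots,vb$. Every node $u$ receives an independent copy $\mathcal V^{(u)}$ of $\mathcal V$. The tree with $n\ge1$ balls is described by counts $n_v$,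 $v\in[b]^*$: the root has count $n$; if $n_v\le s$, all proper descendants of $v$ have count $0$; if $n_v>s$, then conditionally on $n_v$ and $\mathcal V^{(v)}=(V_1,\dots,V_b)$, $(n_{v1},\dots,n_{vb})$ is distributed as the first $b$ coordinates of $\mathrm{Mult}\bigl(n_v-s_0-bs_1;\,V_1,\dots,V_b,1-\sum_iV_i\bigr)+(s_1,\dots,s_1,0)$, with the usual independence between different subtrees. $T_n$ is the set of nodes $v$ with $n_v>0$ (together with the ball counts); $T_0$ is empty. For $v\in T_n$, the fringe subtree $T_n^v$ is $v$ together with all its descendants in $T_n$; conditionally on $n_v=m$ it is distributed as $T_m$. Additive functionals. A toll function $\phi$ is a real-valued function on trees with balls. Put $\phi_m=\mathbb E[\phi(T_m)]$ for $m\ge1$ and $X_n(\phi)=\sum_{v\in T_n}\phi(T_n^v)$. For $k\ge1$, $\delta_k$ is the toll function $\delta_k(T)=\mathbf 1(T\text{ has }k\text{ balls})$, so $X_n(\delta_k)=\#\{v\in T_n:n_v=k\}$. Parameters. $\beta\in(0,1]$ is the unique number with $\mathbb E\sum_{i=1}^bV_i^\beta=1$. $V:=V_I$ with $I$ uniform on $[b]$ independent of $\mathcal V$. $\mu:=\mathbb E[-bV^\beta\ln V]=\sum_{i=1}^b\mathbb E[-V_i^\beta\ln V_i]\in(0,\infty)$. When $\ln V$ is not supported on any lattice $d\mathbb Z$, $d>0$ (nonlattice case, which holds here as $V$ is Beta-distributed), for a toll function with $\phi_n=O(n^{\beta-\delta})$ for some $\delta>0$, $\varpi[\phi]$ denotes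 the (existing and unique) constant with $\mathbb E[X_n(\phi)]=\varpi[\phi]n^\beta+o(n^\beta)$. $B(p,q)$ denotes the Beta distribution with density proportional to $t^{p-1}(1-t)^{q-1}$ on $(0,1)$, $p,q>0$. *)

(* Defs.v *)
From HB Require Import structures.
From mathcomp Require Import all_boot all_order all_algebra.
From mathcomp Require Import all_classical all_reals all_analysis.

Set Implicit Arguments.
Unset Strict Implicit.
Unset Printing Implicit Defensive.

Import Order.TTheory GRing.Theory Num.Theory.
Import numFieldNormedType.Exports.

Local Open Scope classical_set_scope.
Local Open Scope ring_scope.

Section SpecialFunctions.
Variable R : realType.
Implicit Types t x p q : R.

Definition Gamma x : R :=
  \int[lebesgue_measure]_(t in `]0, +oo[) (t `^ (x - 1) * expR (- t)).

Definition digamma x : R := derive1 Gamma x / Gamma x.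

(* The library's beta distribution only has integer parameters. *)
Definition beta_weight p q t : R := t `^ (p - 1) * (1 - t) `^ (q - 1).

Definition beta_const p q : R :=
  \int[lebesgue_measure]_(t in `]0, 1[) beta_weight p q t.

Definition beta_distributed d (T : measurableType d) (P : probability T R)
    (X : T -> R) p q :=
  [/\ 0 < p, 0 < q & forall A : set R, measurable A ->
    P (X @^-1` A) =
    (\int[lebesgue_measure]_(t in A `&` `]0%R, 1%R[)
       (beta_weight p q t / beta_const p q)%:E)%E].

End SpecialFunctions.

Section SplitVector.
Variables (R : realType) (b : nat).

(* [order_stat v j] is the j-th largest entry of v, j = 1, ..., b. *)
Definition order_stat (v : b.-tuple R) (j : nat) : R :=
  nth 0 (sort (fun x y : R => y <= x) v) j.-1.

Record split_vector d (T : measurableType d) (P : probability T R)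
    (V : {RV P >-> b.-tuple R}) : Prop := SplitVector {
  sv_simplex : {ae P, forall w,
    (forall i, 0 <= tnth (V w) i) /\ \sum_(i < b) tnth (V w) i <= 1} ;
  sv_max : (P [set w | (order_stat (V w) 1 = 1)%R] < 1)%E ;
  sv_min : (0 < P [set w | (0 < order_stat (V w) b)%R])%E ;
  sv_pos : (1 < \sum_(i < b) P [set w | (0 < tnth (V w) i)%R])%E }.

Record uniform_indep_index d (T : measurableType d) (P : probability T R)
    (V : {RV P >-> b.-tuple R}) (I : T -> 'I_b) : Prop := UniformIndepIndex {
  ui_meas : forall i, measurable (I @^-1` [set i]) ;
  ui_unif : forall i, P (I @^-1` [set i]) = (b%:R^-1)%:E ;
  ui_indep : forall i (A : set (b.-tuple R)), measurable A ->
    P (I @^-1` [set i] `&` V @^-1` A) =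
    (P (I @^-1` [set i]) * P (V @^-1` A))%E }.

(* 0 `^ beta * ln 0 = 0 for beta != 0, as required where V_I vanishes. *)
Definition split_mu d (T : measurableType d) (P : probability T R)
    (VI : T -> R) (beta : R) : \bar R :=
  ('E_P[fun w => (- b%:R * (VI w `^ beta) * ln (VI w))%R])%E.

Definition mult_pmf (r m : nat) (p : r.-tuple R) (x : 'I_r -> nat) : R :=
  if (\sum_(j < r) x j == m)%N then
    m`!%:R / \prod_(j < r) (x j)`!%:R * \prod_(j < r) tnth p j ^+ x j
  else 0.

(* Probability that (c_1, ..., c_b) are the first b coordinates of
   Mult(m; v_1, ..., v_b, 1 - sum_i v_i) + (s1, ..., s1, 0). *)
Definition children_pmf (s1 m : nat) (v : b.-tuple R) (c : 'I_b -> nat) : R :=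
  \sum_(x : {ffun 'I_b.+1 -> 'I_m.+1} |
        [forall i : 'I_b, (x (lift ord_max i) + s1 == c i)%N])
    mult_pmf m [tuple of rcons v (1 - \sum_(i < b) tnth v i)]
      (fun j => nat_of_ord (x j)).

End SplitVector.

Definition mutually_independent (R : realType) d (T : measurableType d)
    (P : probability T R) d' (T' : measurableType d') (I : eqType)
    (X : I -> T -> T') :=
  forall (us : seq I) (A : I -> set T'), uniq us ->
    (forall u, measurable (A u)) ->
    P (\bigcap_(u in [set` us]) (X u @^-1` A u)) =
    (\prod_(u <- us) P (X u @^-1` A u))%E.

Section Trees.
Variable b : nat.

(* A tree with balls is given by its ball counts n_v; its nodes are the words
   v with n_v > 0, so T_0 is the zero function. *)
Definition ball_tree := seq 'I_b -> nat.

Definition fringe (t : ball_tree) (v : seq 'I_b) : ball_tree :=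
  fun w => t (v ++ w).

Definition strict_desc (v w : seq 'I_b) : bool := prefix v w && (w != v).

Variable R : realType.

(* Finitely supported sum; it is 0 by convention if infinitely many nodes
   contribute. *)
Definition additive_functional (phi : ball_tree -> R) (t : ball_tree) : R :=
  \sum_(v \in [set v | (0 < t v)%N]) phi (fringe t v).

Definition delta (k : nat) : ball_tree -> R := fun t => (t [::] == k)%:R.

End Trees.

Section SplitTree.
Variables (R : realType) (b s s0 s1 : nat) (nu : probability (b.-tuple R) R).

(* The events known before the balls of v are split: those generated by all
   the split vectors and by the counts of all nodes that are not proper
   descendants of v. *)
Definition past d (T : measurableType d) (V : seq 'I_b -> T -> b.-tuple R)
    (N : seq 'I_b -> T -> nat) (v : seq 'I_b) : set (set T) :=
  <<s [set B | exists u (A : set (b.-tuple R)),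
                 measurable A /\ B = V u @^-1` A] `|`
      [set B | exists w k, ~~ strict_desc v w /\ B = N w @^-1` [set k]] >>.

(* The random tree T_n, where nu is the law of the split vector.  By
   [st_split] the counts of the children of v have, conditionally on [past v],
   a law that depends only on n_v and on the split vector of v; this includes
   the independence between different subtrees. *)
Record split_tree (n : nat) := SplitTree {
  st_disp : measure_display ;
  st_space : measurableType st_disp ;
  st_prob : probability st_space R ;
  st_vec : seq 'I_b -> {RV st_prob >-> b.-tuple R} ;
  st_count : seq 'I_b -> st_space -> nat ;
  st_vec_law : forall u (A : set (b.-tuple R)), measurable A ->
    st_prob (st_vec u @^-1` A) = nu A ;
  st_vec_indep : mutually_independent st_prob (fun u => st_vec u : _ -> _) ;
  st_count_meas : forall v k, measurable (st_count v @^-1` [set k]) ;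
  st_root : forall w, st_count [::] w = n ;
  st_stop : forall v v' w, (st_count v w <= s)%N -> strict_desc v v' ->
    st_count v' w = 0%N ;
  st_split : forall v (c : 'I_b -> nat) G,
    past (fun u => st_vec u : _ -> _) st_count v G ->
    st_prob (G `&` [set w | (s < st_count v w)%N /\
                            forall i, st_count (rcons v i) w = c i]) =
    (\int[st_prob]_(w in G `&` [set w | (s < st_count v w)%N])
       (children_pmf s1 (st_count v w - s0 - b * s1)%N (st_vec v w) c)%:E)%E }.

Definition tree_of n (T : split_tree n) (w : st_space T) : ball_tree b :=
  fun v => st_count v w.

(* c is the constant varpi[phi]: E[X_n(phi)] = c n^beta + o(n^beta), where the
   expectations are finite. *)
Definition is_varpi (T : forall n, split_tree n) (beta : R)
    (phi : ball_tree b -> R) (c : R) :=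
  exists r : nat -> R,
    (forall n, (0 < n)%N ->
      ('E_(st_prob (T n))[fun w => additive_functional phi (tree_of w)] =
       (c * n%:R `^ beta + r n)%:E)%E) /\
    r =o_\oo (fun n : nat => n%:R `^ beta : R).

End SplitTree.

(* Main.v *)
Require Import Defs.
From HB Require Import structures.
From mathcomp Require Import all_boot all_order all_algebra.
From mathcomp Require Import all_classical all_reals all_analysis.
From mathcomp Require Import measurable_realfun ring lra zify.

Set Implicit Arguments.
Unset Strict Implicit.

Import Order.TTheory GRing.Theory Num.Theory.
Import numFieldNormedType.Exports.

Local Open Scope classical_set_scope.
Local Open Scope ring_scope.

(** Write [al = a + beta], [(x)_m] for the rising factorial and, for the number [n] of balls of
    a node, [n' = n - s1].  Let [r = s0 + (b - 1) s1], an integer, which is positive because it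
    is a Beta parameter; in the code it appears as [q.+1].

    The mean recursion.  A node with [n > s] balls has [s1 + Bin (n' - r, V_i)] balls in its
    [i]-th child.  The mixture of the laws of the [V_i] is Beta (a, r), so the mean number
    [K n j] of children with [j] balls is [b] times a beta-binomial weight.  As
    [E sum_i V_i ^ beta = 1] means [b (a)_r = (al)_r] ([rising_malthusian]), this number is
    [(al)_r (n' - r)! / (a)_n' * C (n' - 1 - j', r - 1) * (a)_j' / j'!]
    ([beta_binomial_kernel]), and the expected number [e n] of nodes with [k] balls satisfies
    [e n = [n = k] + [n > s] sum_j K n j * e j].

    Its explicit solution.  [(al)_n' / (a)_n'] is harmonic for [K].  Dividing by it leaves the
    probability that a decreasing chain with beta-binomial (al, r) jumps hits [k'].  A
    Beta (al, r) variable is the product of independent Beta (al + i, 1) variables, [i < r], and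
    a jump with second parameter [1] walks down the integers and stops at level [y] with an
    explicit probability.  So the chain is a walk around a cycle of [r] phases, whose phase [i]
    advances at level [y] with probability [(al + i) / (al + y)] ([phase]).  The
    average of the phases with weights [1 / (al + i)] is conserved and, as the series of
    [1 / (al + y)] diverges, all phases converge to it ([cyclic_averaging]).  This gives the
    limit [1 / ((al + k') M)] with [M = sum_(i < r) 1 / (al + i)], and since
    [Gamma (x + beta)] is equivalent to [x ^ beta Gamma x], [e n / n ^ beta] converges to
    [Gamma (a + k') / (M Gamma (al + k' + 1))] ([euler_sol_cvg]).

    The constants.  [mu = M]: both the Beta integral and the one with the extra weight [- ln t]
    satisfy the same recursion in the integer parameter [r], and [M] is a difference of digamma
    functions because [Gamma (x + 1) = x Gamma x].  The bound on [a] and its equality case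
    compare [(al)_r = b (a)_r] with [(a + 1)_r = (a)_r (a + r) / a].

    The tree.  The number of balls of a node [v] is independent of the split vectors of the
    nodes that are not strict ancestors of [v] ([vec_indep_countP]).  Hence the mean number
    [M_d j] of nodes at depth [d] with [j] balls obeys [M_(d+1) j = sum_l M_d l * K l j], and
    pairing [M_d] with [e] telescopes to [sum_d M_d k = e n] ([sum_words_prob]).  The sum is
    finite, since the number of balls almost surely decreases from a parent with balls to its
    children. *)

(** * Improper integrals from antiderivatives *)

Section ImproperFTC.
Variable R : realType.
Local Notation mu := (@lebesgue_measure R).

(** Improper fundamental theorem of calculus: on each compact interval of the exhaustion the
    two integrals are finite and differ by an increment of [F]; monotone convergence passes to
    the union.  Two nonnegative integrands, rather than their difference, let this serve as an
    integration by parts even when the integrals may be infinite. *)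
Lemma exhaustion_FTC (f1 f2 F : R -> R) (D : set R) (x y : nat -> R) (L : R) :
  open D -> (forall n, x n < y n) ->
  nondecreasing_seq (fun n => `[x n, y n]%classic) ->
  \bigcup_n `[x n, y n]%classic = D ->
  (forall t, D t -> 0 <= f1 t) -> (forall t, D t -> 0 <= f2 t) ->
  (forall t, D t -> {for t, continuous f1}) ->
  (forall t, D t -> {for t, continuous f2}) ->
  (forall t, D t -> is_derive t 1 F (f1 t - f2 t)) ->
  (F (y n) - F (x n)) @[n --> \oo] --> L ->
  (\int[mu]_(t in D) (f1 t)%:E = L%:E + \int[mu]_(t in D) (f2 t)%:E)%E.
Proof.
move=> oD xy ndI ID f10 f20 c1 c2 dF FL.
have ID' n : `[x n, y n]%classic `<=` D by rewrite -ID => t ?; exists n.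
have mf (f : R -> R) : (forall t, D t -> {for t, continuous f}) ->
    measurable_fun D f.
  by move=> cf; apply: open_continuous_measurable_fun => // t; rewrite inE; exact: cf.
have cvgf (f : R -> R) : (forall t, D t -> 0 <= f t) ->
    (forall t, D t -> {for t, continuous f}) ->
    (\int[mu]_(t in `[x n, y n]) (f t)%:E)%E @[n --> \oo]
      --> (\int[mu]_(t in D) (f t)%:E)%E.
  move=> f0 cf; rewrite -ID.
  apply: ge0_nondecreasing_set_cvg_integral => //.
  - move=> n; apply/measurable_EFinP; apply: measurable_funS (mf _ cf) => //.
    exact: open_measurable.
  - by move=> n t tn; rewrite lee_fin; apply: f0; exact: ID' tn.
have cI (f : R -> R) n : (forall t, D t -> {for t, continuous f}) ->
    {within `[x n, y n], continuous f}.
  move=> cf; apply: continuous_in_subspaceT => t; rewrite inE => tn.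
  by apply: cf; exact: (ID' n).
have iI (f : R -> R) n : (forall t, D t -> {for t, continuous f}) ->
    mu.-integrable `[x n, y n] (EFin \o f).
  by move=> cf; apply: continuous_compact_integrable;
    [exact: segment_compact|exact: cI].
have key n : (\int[mu]_(t in `[x n, y n]) (f1 t)%:E =
    (F (y n) - F (x n))%:E + \int[mu]_(t in `[x n, y n]) (f2 t)%:E)%E.
  have cF : {within `[x n, y n], continuous F}.
    apply: derivable_within_continuous => t tn.
    by have [] := dF t (ID' n t tn).
  have := @continuous_FTC2 R (fun t => f1 t - f2 t) F (x n) (y n) (xy n).
  rewrite -EFinB => <-; last 3 first.
  - apply: cI => t Dt; apply: cvgB; [exact: c1|exact: c2].
  - have /(continuous_within_itvP F (xy n))[cl cr cb] := cF.
    split=> // t tn.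
    have Dt : D t by apply: (ID' n); exact: subset_itv_oo_cc tn.
    by have [] := dF t Dt.
  - move=> t tn.
    have Dt : D t by apply: (ID' n); exact: subset_itv_oo_cc tn.
    by rewrite derive1E; have [_] := dF t Dt.
  under [X in _ = (X + _)%E]eq_integral do rewrite EFinB.
  rewrite integralB_EFin//; [|exact: iI|exact: iI].
  by rewrite subeK//; apply: integrable_fin_num => //; exact: iI.
have /cvg_lim <- // := cvgf _ f10 c1.
apply/cvg_lim => //.
under eq_cvg do rewrite key.
apply: cvgeD; last exact: cvgf.
- exact: fin_num_adde_defr.
- by apply: cvg_EFin => //; exact: nearW.
Qed.

Lemma ge0_FTC_itv01 (f1 f2 F : R -> R) :
  (forall t : R, 0 < t < 1 -> 0 <= f1 t) -> (forall t : R, 0 < t < 1 -> 0 <= f2 t) ->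
  (forall t : R, 0 < t < 1 -> {for t, continuous f1}) ->
  (forall t : R, 0 < t < 1 -> {for t, continuous f2}) ->
  (forall t : R, 0 < t -> is_derive t 1 F (f1 t - f2 t)) ->
  F x @[x --> 0^'+] --> 0 ->
  (\int[mu]_(t in `]0%R, 1%R[) (f1 t)%:E =
   (F 1)%:E + \int[mu]_(t in `]0%R, 1%R[) (f2 t)%:E)%E.
Proof.
move=> f10 f20 c1 c2 dF F0.
pose x n : R := n.+3%:R^-1.
have xlt n : x n < 1 - x n.
  rewrite ltrBrDr /x -div1r -mulrDl ltr_pdivrMr// mul1r.
  by rewrite -[1 + 1]/(2%:R) ltr_nat.
have x0 n : 0 < x n by rewrite invr_gt0.
have xnd m n : (m <= n)%N -> x n <= x m.
  by move=> mn; rewrite lef_pV2 ?posrE// ler_nat !ltnS.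
have xcvg : x n @[n --> \oo] --> 0.
  rewrite (_ : x = fun n => harmonic (n + 2)%N); last first.
    by apply/funext => n; rewrite /x /harmonic addn2.
  by rewrite (@cvg_shiftn 2 R (@harmonic R)); exact: cvg_harmonic.
apply: (@exhaustion_FTC _ _ F _ x (fun n => 1 - x n)) => //.
- move=> m n mn; apply/subsetPset => t /=; rewrite !in_itv/= => /andP[a b].
  by apply/andP; split; [exact: le_trans (xnd _ _ mn) a|
    apply: le_trans b _; rewrite lerB// xnd].
- apply/seteqP; split=> [t [n _ /=]|t /=].
    rewrite !in_itv/= => /andP[a b].
    by rewrite (lt_le_trans (x0 n) a)/= (le_lt_trans b)// ltrBlDr ltrDl.
  rewrite in_itv/= => /andP[t0 t1].
  have tt : 0 < Num.min t (1 - t) by rewrite lt_min t0 subr_gt0.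
  have /cvgrPdist_lt/(_ _ tt)[N _ /(_ N (leqnn N))] := xcvg.
  rewrite sub0r normrN gtr0_norm// lt_min => /andP[/ltW a b].
  exists N => //=; rewrite in_itv/= a/=; lra.
- by move=> t /=; rewrite in_itv/= => /andP[t0 _]; exact: dF.
- rewrite -[F 1]subr0; apply: cvgB.
    have cF : {for 1, continuous F}.
      apply: differentiable_continuous; apply/derivable1_diffP.
      by have [] := dF 1 ltr01.
    have h : (1 - x n) @[n --> \oo] --> (1 - 0 : R).
      by apply: cvgB xcvg; exact: cvg_cst.
    by rewrite subr0 in h; exact: (cvg_comp _ _ h cF).
  by have /cvg_at_rightP/(_ x) := F0; apply.
Qed.
End ImproperFTC.

(** * Beta integrals with an integer second parameter *)

Section BetaIntegrals.
Variable R : realType.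
Local Notation mu := (@lebesgue_measure R).
Implicit Types p t : R.

Definition rising (x : R) (m : nat) : R := \prod_(i < m) (x + i%:R).

Lemma rising0 x : rising x 0 = 1.
Proof. by rewrite /rising big_ord0. Qed.

Lemma risingSr x m : rising x m.+1 = rising x m * (x + m%:R).
Proof. by rewrite /rising big_ord_recr. Qed.

Lemma risingSl x m : rising x m.+1 = x * rising (x + 1) m.
Proof.
rewrite /rising big_ord_recl addr0; congr (_ * _); apply: eq_bigr => i _.
by rewrite -addrA -natr1 [_ + 1]addrC.
Qed.

Lemma rising_gt0 x m : 0 < x -> 0 < rising x m.
Proof.
by move=> x0; apply: prodr_gt0 => i _; exact: ltr_wpDr.
Qed.

Lemma continuous_powR_gt0 p t : 0 < t -> {for t, continuous (fun x => x `^ p)}.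
Proof.
move=> t0; apply: differentiable_continuous; apply/derivable1_diffP.
by have [] := @is_derive1_powR R p t t0.
Qed.

Lemma powRD_gt0 t p q : 0 < t -> t `^ (p + q) = t `^ p * t `^ q.
Proof. by move=> t0; rewrite powRD// (gt_eqF t0) implybT. Qed.

Lemma powRSr t p : 0 < t -> t `^ p = t * t `^ (p - 1).
Proof.
by move=> t0; rewrite -{2}(powRr1 (ltW t0)) -powRD_gt0// subrKC.
Qed.

Lemma ge0_integral_powR01 p : 0 < p ->
  (\int[mu]_(t in `]0%R, 1%R[) (t `^ (p - 1))%:E = (p^-1)%:E)%E.
Proof.
move=> p0.
transitivity ((1 `^ p / p)%:E + \int[mu]_(t in `]0%R, 1%R[) 0%:E)%E; last first.
  by rewrite integral0 adde0 powR1 mul1r.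
apply: (@ge0_FTC_itv01 _ _ _ (fun t => t `^ p / p)).
- by move=> t _; exact: powR_ge0.
- by [].
- by move=> t /andP[t0 _]; exact: continuous_powR_gt0.
- by move=> t _; exact: cvg_cst.
- move=> t t0; rewrite subr0.
  have h := @is_derive1_powR R p t t0.
  apply: is_derive_eq.
  rewrite /GRing.scale/=.
  by field; rewrite gt_eqF.
- rewrite -[X in _ --> X](mul0r p^-1); apply: cvgM; last exact: cvg_cst.
  exact: powR_cvg0.
Qed.

Lemma ln_le_powR (e t : R) : 0 < e -> 0 < t -> ln t <= t `^ e / e.
Proof.
move=> e0 t0; rewrite ler_pdivlMr// mulrC -ln_powR.
by apply/ltW/ln_sublinear; exact: powR_gt0.
Qed.

Lemma Nln_le_powR (e t : R) : 0 < e -> 0 < t -> - ln t <= t `^ (- e) / e.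
Proof.
move=> e0 t0; rewrite ler_pdivlMr// mulrC mulrN -mulNr -ln_powR.
by apply/ltW/ln_sublinear; exact: powR_gt0.
Qed.

(** Half of the power of [t] absorbs the logarithm. *)
Lemma powR_Nln_cvg0 p : 0 < p -> t `^ p * (- ln t) @[t --> 0^'+] --> 0.
Proof.
move=> p0; have p2 : 0 < p / 2 by rewrite divr_gt0.
apply: (@squeeze_cvgr _ _ _ _ (cst 0) (fun t => t `^ (p / 2) * (p / 2)^-1)).
- near=> t.
  have t0 : 0 < t by near: t; exact: nbhs_right_gt.
  have t1 : t < 1 by near: t; exact: nbhs_right_lt.
  rewrite mulr_ge0 ?powR_ge0 ?oppr_ge0 ?ln_le0 ?(ltW t1)//=.
  rewrite (_ : t `^ p = t `^ (p / 2) * t `^ (p / 2)); last first.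
    by rewrite -powRD_gt0// -splitr.
  rewrite -mulrA ler_pM2l ?powR_gt0//.
  apply: le_trans (ler_wpM2l (powR_ge0 _ _) (Nln_le_powR p2 t0)) _.
  by rewrite mulrA -powRD_gt0// subrr powRr0 mul1r.
- exact: cvg_cst.
- rewrite -[X in _ --> X](mul0r (p / 2)^-1); apply: cvgM; last exact: cvg_cst.
  exact: powR_cvg0.
Unshelve. all: by end_near. Qed.

(** Integration by parts with antiderivative [t ^ p * (- ln t) / p]. *)
Lemma ge0_integral_powR_Nln01 p : 0 < p ->
  (\int[mu]_(t in `]0%R, 1%R[) (t `^ (p - 1) * - ln t)%:E = (p^-1 * p^-1)%:E)%E.
Proof.
move=> p0.
transitivity ((1 `^ p * (- ln 1) / p)%:E +
    \int[mu]_(t in `]0%R, 1%R[) (t `^ (p - 1) / p)%:E)%E; last first.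
  rewrite ln1 oppr0 mulr0 mul0r add0e.
  under eq_integral do rewrite EFinM.
  rewrite ge0_integralZr//=.
  - by rewrite ge0_integral_powR01.
  - apply/measurable_EFinP.
    by apply: measurable_funTS; exact: measurable_powR.
  - by move=> t _; rewrite lee_fin powR_ge0.
  - by rewrite lee_fin invr_ge0 ltW.
apply: (@ge0_FTC_itv01 _ _ _ (fun t => t `^ p * (- ln t) / p)).
- move=> t /andP[t0 t1]; rewrite mulr_ge0 ?powR_ge0// oppr_ge0 ln_le0// ltW//.
- by move=> t _; rewrite mulr_ge0 ?powR_ge0// invr_ge0 ltW.
- move=> t /andP[t0 _]; apply: cvgM; first exact: continuous_powR_gt0.
  by apply: cvgN; exact: continuous_ln.
- by move=> t /andP[t0 _]; apply: cvgM; [exact: continuous_powR_gt0|exact: cvg_cst].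
- move=> t t0.
  have h1 := @is_derive1_powR R p t t0.
  have h2 := @is_derive1_ln R t t0.
  apply: is_derive_eq.
  rewrite /GRing.scale/=.
  rewrite (powRSr p t0).
  by field; rewrite !gt_eqF.
- rewrite -[X in _ --> X](mul0r p^-1); apply: cvgM; last exact: cvg_cst.
  exact: powR_Nln_cvg0.
Qed.
End BetaIntegrals.

Section BetaRecursion.
Variable R : realType.
Local Notation mu := (@lebesgue_measure R).
Local Notation D := (`]0%R, 1%R[%classic : set R).
Implicit Types p t : R.

Lemma onemX_itv01 t m : 0 < t < 1 -> 0 <= (1 - t) ^+ m <= 1.
Proof.
move=> /andP[t0 t1]; rewrite exprn_ge0 ?subr_ge0 ?(ltW t1)//=.
by rewrite exprn_ile1 ?subr_ge0 ?(ltW t1)// gerBl ltW.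
Qed.

Lemma integrable_onemX (w : R -> R) m : mu.-integrable D (EFin \o w) ->
  mu.-integrable D (EFin \o (fun t => w t * (1 - t) ^+ m)).
Proof.
move=> iw; apply: le_integrable (iw) => //=.
  have /integrableP[/measurable_EFinP mw _] := iw.
  apply/measurable_EFinP; apply: measurable_funM => //.
  by apply: measurable_funTS; apply: measurable_funX; exact: measurable_funB.
move=> t /=; rewrite in_itv/= => /(onemX_itv01 m)/andP[a b].
by rewrite lee_fin normrM ler_piMr// ger0_norm.
Qed.

(** The recursion on the integer parameter that the plain and the logarithmic Beta integrals
    share: [(1 - t) ^ m.+1 = (1 - t) ^ m - t (1 - t) ^ m]. *)
Lemma Rintegral_onemXS (w : R -> R) m : mu.-integrable D (EFin \o w) ->
  \int[mu]_(t in D) (w t * (1 - t) ^+ m.+1) =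
  \int[mu]_(t in D) (w t * (1 - t) ^+ m) -
  \int[mu]_(t in D) (t * w t * (1 - t) ^+ m).
Proof.
move=> iw; rewrite -RintegralB//; last 2 first.
- exact: integrable_onemX.
- apply: integrable_onemX; apply: le_integrable (iw) => //=.
    have /integrableP[/measurable_EFinP mw _] := iw.
    by apply/measurable_EFinP; apply: measurable_funM.
  move=> t /=; rewrite in_itv/= => /andP[a b].
  by rewrite lee_fin normrM ler_piMl// ger0_norm ltW.
by apply: eq_Rintegral => t _; rewrite exprS; ring.
Qed.

Lemma ge0_Rintegral_of_integral (f : R -> R) (v : R) : (forall t, D t -> 0 <= f t) ->
  measurable_fun D f -> (\int[mu]_(t in D) (f t)%:E = v%:E)%E ->
  mu.-integrable D (EFin \o f) /\ \int[mu]_(t in D) f t = v.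
Proof.
move=> f0 mf fv; split; last by rewrite /Rintegral fv.
apply/integrableP; split; first exact/measurable_EFinP.
under eq_integral => t tD.
  rewrite abse_EFin ger0_norm; last by apply: f0; rewrite inE in tD.
  over.
by rewrite fv ltry.
Qed.

Lemma integrable_Rintegral_powR01 p : 0 < p -> mu.-integrable D (EFin \o (fun t => t `^ (p - 1))) /\
  \int[mu]_(t in D) (t `^ (p - 1)) = p^-1.
Proof.
move=> p0; apply: ge0_Rintegral_of_integral; last exact: ge0_integral_powR01.
  by move=> t _; exact: powR_ge0.
by apply: measurable_funTS; exact: measurable_powR.
Qed.

Lemma integrable_Rintegral_powR_Nln01 p : 0 < p ->
  mu.-integrable D (EFin \o (fun t => t `^ (p - 1) * - ln t)) /\
  \int[mu]_(t in D) (t `^ (p - 1) * - ln t) = p^-1 * p^-1.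
Proof.
move=> p0; apply: ge0_Rintegral_of_integral; last exact: ge0_integral_powR_Nln01.
  move=> t/=; rewrite in_itv/= => /andP[t0 t1].
  by rewrite mulr_ge0 ?powR_ge0// oppr_ge0 ln_le0// ltW.
apply: measurable_funTS; apply: measurable_funM; first exact: measurable_powR.
by apply: measurableT_comp => //; exact: measurable_ln.
Qed.

(** The Beta function at [(p, m + 1)]. *)
Definition beta_int p m : R := m`!%:R / rising p m.+1.

(** The logarithmic derivative of [rising] in [p]. *)
Definition rising_harmonic p m : R := \sum_(i < m) (p + i%:R)^-1.

Lemma Rintegral_beta p m : 0 < p ->
  \int[mu]_(t in D) (t `^ (p - 1) * (1 - t) ^+ m) = beta_int p m.
Proof.
elim: m p => [|m IH] p p0.
  under eq_Rintegral do rewrite expr0 mulr1.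
  by rewrite (integrable_Rintegral_powR01 p0).2 /beta_int fact0 risingSr rising0 addr0 !mul1r.
have p1 : 0 < p + 1 by rewrite addr_gt0.
rewrite (Rintegral_onemXS _ (integrable_Rintegral_powR01 p0).1) IH//.
under eq_Rintegral => t tD.
  have t0 : 0 < t by move: tD; rewrite inE/= in_itv/= => /andP[].
  rewrite -powRSr// -{1}(addrK 1 p).
  over.
rewrite IH// /beta_int (risingSr (p + 1)).
rewrite (risingSr p m.+1) (risingSl p m) factS natrM.
have r0 := @rising_gt0 _ (p + 1) m p1.
have m0 : (0 : R) <= m%:R by [].
rewrite -addrA -natr1.
field; rewrite !gt_eqF//=; lra.
Qed.

(** Minus the [p]-derivative of the Beta integral, obtained from the same induction on [m]. *)
Lemma Rintegral_beta_ln p m : 0 < p ->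
  \int[mu]_(t in D) (t `^ (p - 1) * (- ln t) * (1 - t) ^+ m) =
  beta_int p m * rising_harmonic p m.+1.
Proof.
elim: m p => [|m IH] p p0.
  under eq_Rintegral do rewrite expr0 mulr1.
  rewrite (integrable_Rintegral_powR_Nln01 p0).2 /beta_int fact0 risingSr rising0 addr0 !mul1r.
  by rewrite /rising_harmonic big_ord1 addr0.
have p1 : 0 < p + 1 by rewrite addr_gt0.
rewrite (Rintegral_onemXS _ (integrable_Rintegral_powR_Nln01 p0).1) IH//.
under eq_Rintegral => t tD.
  have t0 : 0 < t by move: tD; rewrite inE/= in_itv/= => /andP[].
  rewrite mulrA -powRSr// -{1}(addrK 1 p).
  over.
have harmE : rising_harmonic (p + 1) m.+1 = rising_harmonic p m.+1 - p^-1 + (p + m.+1%:R)^-1.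
  rewrite /rising_harmonic [in RHS]big_ord_recl addr0 [_ + \sum_(_ < _) _]addrC addrK.
  rewrite big_ord_recr/=; congr (_ + _).
    by apply: eq_bigr => i _; rewrite -addrA /bump/= -natr1 [_ + 1]addrC.
  by rewrite -addrA -natr1 [_ + 1]addrC.
rewrite IH// harmE [in RHS]/rising_harmonic big_ord_recr/= -/(rising_harmonic p m.+1).
rewrite /beta_int (risingSr (p + 1)).
rewrite (risingSr p m.+1) (risingSl p m) factS natrM.
have r0 := @rising_gt0 _ (p + 1) m p1.
have m0 : (0 : R) <= m%:R by [].
rewrite -addrA -natr1.
field; rewrite !gt_eqF//=; lra.
Qed.

Lemma beta_weight_nat p m t : 0 < t < 1 ->
  beta_weight p m.+1%:R t = t `^ (p - 1) * (1 - t) ^+ m.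
Proof.
move=> /andP[t0 t1]; rewrite /beta_weight -natr1 addrK powR_mulrn//.
by rewrite subr_ge0 ltW.
Qed.

Lemma beta_constE p m : 0 < p -> beta_const p m.+1%:R = beta_int p m.
Proof.
move=> p0; rewrite -Rintegral_beta//; apply: eq_Rintegral => t.
by rewrite inE/= in_itv/= => h; rewrite beta_weight_nat.
Qed.

End BetaRecursion.

(** * The Gamma and digamma functions *)

Section GammaFunction.
Variable R : realType.
Local Notation mu := (@lebesgue_measure R).
Local Notation D := (`]0%R, +oo[%classic : set R).
Implicit Types x t p : R.

Lemma invr_natSS_cvg0 : (n.+2%:R^-1 : R) @[n --> \oo] --> 0.
Proof.
rewrite (_ : (fun n => n.+2%:R^-1) = fun n => @harmonic R (n + 1)%N); last first.
  by apply/funext => n; rewrite /harmonic addn1.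
by rewrite (@cvg_shiftn 1 R (@harmonic R)); exact: cvg_harmonic.
Qed.

Lemma natSS_cvgy : (n.+2%:R : R) @[n --> \oo] --> +oo.
Proof.
rewrite (_ : (fun n => n.+2%:R) = fun n => (n + 2)%:R :> R); last first.
  by apply/funext => n; rewrite addn2.
by rewrite (@cvg_shiftn 2 _ (fun n => n%:R : R)); exact: cvgr_idn.
Qed.

Lemma ge0_FTC_itv0y (f1 f2 F : R -> R) (l0 l1 : R) :
  (forall t, 0 < t -> 0 <= f1 t) -> (forall t, 0 < t -> 0 <= f2 t) ->
  (forall t, 0 < t -> {for t, continuous f1}) ->
  (forall t, 0 < t -> {for t, continuous f2}) ->
  (forall t, 0 < t -> is_derive t 1 F (f1 t - f2 t)) ->
  F t @[t --> 0^'+] --> l0 -> F t @[t --> +oo] --> l1 ->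
  (\int[mu]_(t in D) (f1 t)%:E =
   (l1 - l0)%:E + \int[mu]_(t in D) (f2 t)%:E)%E.
Proof.
move=> f10 f20 c1 c2 dF F0 F1.
have x0 n : (0 : R) < n.+2%:R^-1 by rewrite invr_gt0.
have xnd m n : (m <= n)%N -> n.+2%:R^-1 <= m.+2%:R^-1 :> R.
  by move=> mn; rewrite lef_pV2 ?posrE// ler_nat !ltnS.
apply: (@exhaustion_FTC _ _ _ F _ (fun n => n.+2%:R^-1) (fun n => n.+2%:R)) => //.
- by move=> n; rewrite (@lt_trans _ _ 1) ?invf_lt1 ?ltr1n.
- move=> m n mn; apply/subsetPset => t /=; rewrite !in_itv/= => /andP[a b].
  by rewrite (le_trans (xnd _ _ mn) a)/= (le_trans b)// ler_nat !ltnS.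
- apply/seteqP; split=> [t [n _ /=]|t /=].
    by rewrite !in_itv/= => /andP[a b]; rewrite andbT (lt_le_trans (x0 n) a).
  rewrite in_itv/= andbT => t0.
  have /cvgrPdist_lt/(_ _ t0)[N _ hN] := invr_natSS_cvg0.
  have /cvgryPge/(_ t)[M _ hM] := natSS_cvgy.
  exists (maxn N M) => //=; rewrite in_itv/= (hM (maxn N M))/= ?leq_maxr// andbT.
  have := hN (maxn N M) (leq_maxl _ _).
  by rewrite sub0r normrN gtr0_norm// => /ltW.
- by move=> t /=; rewrite in_itv/= andbT; exact: f10.
- by move=> t /=; rewrite in_itv/= andbT; exact: f20.
- by move=> t /=; rewrite in_itv/= andbT; exact: c1.
- by move=> t /=; rewrite in_itv/= andbT; exact: c2.
- by move=> t /=; rewrite in_itv/= andbT; exact: dF.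
- apply: cvgB.
    exact: (cvg_comp _ _ natSS_cvgy F1).
  have /cvg_at_rightP/(_ (fun n => n.+2%:R^-1)) := F0.
  by apply; split=> //; exact: invr_natSS_cvg0.
Qed.

(** From [ln u <= u] at [u = t / (2 p)]. *)
Lemma powR_le_expR2 p t : 0 < p -> 0 < t -> t `^ p <= (2 * p) `^ p * expR (t / 2).
Proof.
move=> p0 t0; have p2 : 0 < 2 * p by rewrite mulr_gt0.
have -> : t = (2 * p) * (t / (2 * p)) by rewrite mulrC divfK// gt_eqF.
set u := t / (2 * p); have u0 : 0 < u by rewrite divr_gt0.
rewrite powRM ?(ltW p2) ?(ltW u0)//; rewrite ler_wpM2l ?powR_ge0//.
rewrite {1}/powR gt_eqF// ler_expR.
have -> : 2 * p * u / 2 = p * u by field.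
by rewrite ler_pM2l//; apply/ltW/ln_sublinear.
Qed.

Lemma powR_mul_expRN_half p t : 0 < p -> 0 < t ->
  t `^ p * expR (- (t / 2)) <= (2 * p) `^ p.
Proof.
move=> p0 t0; apply: le_trans (ler_wpM2r (expR_ge0 _) (powR_le_expR2 p0 t0)) _.
by rewrite -mulrA expRxMexpNx_1 mulr1.
Qed.

Lemma continuous_expRNM (c t : R) : {for t, continuous (fun t => expR (- (t * c)))}.
Proof.
apply: continuous_comp; last exact: continuous_expR.
by apply: cvgN; apply: cvgMl; exact: cvg_id.
Qed.

Lemma continuous_expRN (t : R) : {for t, continuous (fun t => expR (- t))}.
Proof. by apply: continuous_comp; [exact: cvgN|exact: continuous_expR]. Qed.

Lemma expRN_half_cvg0 : expR (- (t / 2)) @[t --> +oo] --> (0 : R).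
Proof.
apply: (@cvg_comp _ _ _ (fun t : R => t / 2) (fun t => expR (- t))); last exact: cvgr_expR.
by apply: gt0_cvgMly => //; rewrite ?invr_gt0.
Qed.

Lemma integrable_expRN_half :
  mu.-integrable D (EFin \o (fun t => expR (- (t / 2)))).
Proof.
apply/integrableP; split.
  apply/measurable_EFinP; apply: measurable_funTS.
  by apply: continuous_measurable_fun => t; exact: continuous_expRNM.
under eq_integral do rewrite abse_EFin ger0_norm ?expR_ge0//.
have -> : (\int[mu]_(t in D) (expR (- (t / 2)))%:E =
    (0 - (- 2))%:E + \int[mu]_(t in D) 0%:E)%E.
  apply: (@ge0_FTC_itv0y _ _ (fun t => - 2 * expR (- (t / 2)))) => //.
  - by move=> t _; exact: continuous_expRNM.
  - by move=> t _; exact: cvg_cst.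
  - move=> t t0; apply: is_derive_eq.
    by rewrite /GRing.scale/=; field.
  - rewrite -[X in _ --> X](mulr1 (- 2)); apply: cvgM; first exact: cvg_cst.
    apply: cvg_at_right_filter.
    have := @continuous_expRNM 2^-1 0.
    by rewrite /prop_for /continuous_at/= mul0r oppr0 expR0; apply.
  - rewrite -[X in _ --> X](mulr0 (- 2)); apply: cvgM; first exact: cvg_cst.
    exact: expRN_half_cvg0.
by rewrite integral0 adde0 ltry.
Qed.

Definition gamma_weight x t := t `^ (x - 1) * expR (- t).

Lemma gamma_weight_ge0 x t : 0 <= gamma_weight x t.
Proof. by rewrite mulr_ge0 ?powR_ge0 ?expR_ge0. Qed.

Lemma continuous_gamma_weight x t : 0 < t -> {for t, continuous (gamma_weight x)}.
Proof.
move=> t0; apply: cvgM; first exact: continuous_powR_gt0.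
exact: continuous_expRN.
Qed.

Lemma measurable_gamma_weight x (A : set R) : measurable_fun A (gamma_weight x).
Proof.
apply: measurable_funTS; apply: measurable_funM; first exact: measurable_powR.
by apply: continuous_measurable_fun => t; exact: continuous_expRN.
Qed.

Lemma expRN_split (t : R) : expR (- t) = expR (- (t / 2)) * expR (- (t / 2)).
Proof. by rewrite -expRD; congr expR; field. Qed.

(** Dominated by [t ^ (x - 1)] near [0] and by a decaying exponential at infinity. *)
Lemma integrable_gamma_weight x : 0 < x ->
  mu.-integrable D (EFin \o gamma_weight x).
Proof.
move=> x0.
pose h : R -> R := (fun t => t `^ (x - 1)) \_ `]0%R, 1%R[.
pose C := (2 * x) `^ x.
pose g t := h t + C * expR (- (t / 2)).
have ig : mu.-integrable D (EFin \o g).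
  rewrite (_ : EFin \o g = (EFin \o h \+ (fun t => C%:E * (expR (- (t / 2))%R)%:E))%E);
    last first.
    by apply/funext => t; rewrite /g /= EFinD EFinM.
  apply: integrableD => //.
    rewrite -restrict_EFin; apply/integrable_restrict => //.
    rewrite (_ : D `&` _ = `]0%R, 1%R[%classic); first exact: (integrable_Rintegral_powR01 x0).1.
    by apply/seteqP; split=> t /=; rewrite !in_itv/=; [case|move=> /andP[-> ->]].
  exact: (integrableZl _ _ integrable_expRN_half).
apply: le_integrable ig => //.
  by apply/measurable_EFinP; exact: measurable_gamma_weight.
move=> t /=; rewrite in_itv/= andbT => t0; rewrite lee_fin ger0_norm ?gamma_weight_ge0//.
apply: le_trans (ler_norm _); rewrite /g /h patchE.
have [t1|t1] := ltP t 1.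
  rewrite mem_set/=; last by rewrite in_itv/= t0.
  rewrite -[leLHS]addr0; apply: lerD; last by rewrite mulr_ge0 ?powR_ge0 ?expR_ge0.
  by rewrite ler_piMr ?powR_ge0// -expR0 ler_expR oppr_le0 ltW.
rewrite memNset/= ?add0r; last by rewrite in_itv/= => /andP[_]; rewrite ltNge t1.
rewrite /gamma_weight expRN_split mulrA ler_wpM2r ?expR_ge0//.
apply: (@le_trans _ _ (t `^ x * expR (- (t / 2)))).
  by rewrite ler_wpM2r ?expR_ge0// ler_powR// gerBl.
exact: powR_mul_expRN_half.
Qed.

Lemma GammaS x : 0 < x -> Gamma (x + 1) = x * Gamma x.
Proof.
move=> x0; have x10 : 0 < x + 1 by rewrite addr_gt0.
have E : (\int[mu]_(t in D) (gamma_weight (x + 1) t)%:E =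
    (0 - 0)%:E + \int[mu]_(t in D) (x * gamma_weight x t)%:E)%E.
  apply: (@ge0_FTC_itv0y _ _ (fun t => - (t `^ x * expR (- t)))).
  - by move=> t _; exact: gamma_weight_ge0.
  - by move=> t _; rewrite mulr_ge0 ?gamma_weight_ge0// ltW.
  - by move=> t; exact: continuous_gamma_weight.
  - by move=> t t0; apply: cvgM; [exact: cvg_cst|exact: continuous_gamma_weight].
  - move=> t t0; have h := @is_derive1_powR R x t t0; apply: is_derive_eq.
    by rewrite /GRing.scale/= /gamma_weight addrK; ring.
  - rewrite -[X in _ --> X]oppr0; apply: cvgN.
    rewrite -[X in _ --> X](mul0r 1); apply: cvgM; first exact: powR_cvg0.
    apply: cvg_at_right_filter.
    have := @continuous_expRN 0.
    by rewrite /prop_for /continuous_at/= oppr0 expR0; apply.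
  - rewrite -[X in _ --> X]oppr0; apply: cvgN.
    apply: (@squeeze_cvgr _ _ _ _ (cst 0) (fun t => (2 * x) `^ x * expR (- (t / 2)))).
    + near=> t; have t0 : 0 < t by near: t; exact: nbhs_pinfty_gt.
      rewrite mulr_ge0 ?powR_ge0 ?expR_ge0//= expRN_split mulrA ler_wpM2r ?expR_ge0//.
      exact: powR_mul_expRN_half.
    + exact: cvg_cst.
    + rewrite -[X in _ --> X](mulr0 ((2 * x) `^ x)); apply: cvgM; first exact: cvg_cst.
      exact: expRN_half_cvg0.
rewrite /Gamma -RintegralZl//; last exact: integrable_gamma_weight.
by rewrite /Rintegral E subr0 add0e.
Unshelve. all: by end_near. Qed.

(** The integrand is bounded below by a positive constant on the interval from [1] to [2]. *)
Lemma Gamma_gt0 x : 0 < x -> 0 < Gamma x.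
Proof.
move=> x0.
pose c : R := Num.min 1 (2 `^ (x - 1)) * expR (- 2).
have c0 : 0 < c by rewrite mulr_gt0 ?expR_gt0// lt_min ltr01 powR_gt0.
have sub : `]1%R, 2%R[%classic `<=` D.
  by move=> t /=; rewrite !in_itv/= => /andP[a _]; rewrite (lt_trans _ a).
have H : (c%:E <= \int[mu]_(t in D) (gamma_weight x t)%:E)%E.
  apply: (@le_trans _ _ (\int[mu]_(t in `]1%R, 2%R[) c%:E)%E).
    by rewrite integral_cst//= lebesgue_measure_itv/= lte_fin ltr1n -EFinD -EFinM
      lee_fin (_ : 2 - 1 = 1) ?mulr1//; lra.
  apply: (@le_trans _ _ (\int[mu]_(t in `]1%R, 2%R[) (gamma_weight x t)%:E)%E).
    apply: ge0_le_integral => //.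
    - by move=> t _; rewrite lee_fin ltW.
    - by apply/measurable_EFinP; exact: measurable_gamma_weight.
    - move=> t /=; rewrite in_itv/= => /andP[t1 t2]; rewrite lee_fin.
      apply: ler_pM; rewrite ?expR_ge0 ?ler_expR ?lerN2 ?(ltW t2)//.
      have [x1|x1] := leP 1 x.
        rewrite ge_min; apply/orP; left.
        have : 1 `^ (x - 1) <= t `^ (x - 1).
          by rewrite ge0_ler_powR ?subr_ge0 ?nnegrE// ltW// (lt_trans _ t1).
        by rewrite powR1.
      rewrite ge_min; apply/orP; right.
      rewrite -(opprB 1 x) !powRN lef_pV2 ?posrE ?powR_gt0 ?(lt_trans _ t1)//.
      by rewrite ge0_ler_powR ?subr_ge0 ?nnegrE ?ltW// (lt_trans _ t1).
  apply: ge0_subset_integral => //.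
  - by apply/measurable_EFinP; exact: measurable_gamma_weight.
  - by move=> t _; rewrite lee_fin gamma_weight_ge0.
have fin := integrable_fin_num _ (integrable_gamma_weight x0).
by rewrite -lte_fin /Gamma /Rintegral fineK ?fin// (lt_le_trans _ H).
Qed.
End GammaFunction.

Lemma integrableZl_EFin (R : realType) d (T : measurableType d)
  (m : {measure set T -> \bar R}) (f : T -> R) (A : set T) c : measurable A ->
  m.-integrable A (EFin \o f) -> m.-integrable A (EFin \o (fun t => c * f t)).
Proof.
move=> mA fi; have := integrableZl mA c fi; exact: eq_integrable.
Qed.

Lemma integrableD_EFin (R : realType) d (T : measurableType d)
  (m : {measure set T -> \bar R}) (f g : T -> R) (A : set T) : measurable A ->
  m.-integrable A (EFin \o f) -> m.-integrable A (EFin \o g) ->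
  m.-integrable A (EFin \o (fun t => f t + g t)).
Proof.
move=> mA fi gi; have := integrableD mA fi gi; exact: eq_integrable.
Qed.

Section GammaAsymptotics.
Variable R : realType.
Local Notation mu := (@lebesgue_measure R).
Local Notation D := (`]0%R, +oo[%classic : set R).
Implicit Types x t p : R.

(** Weighted arithmetic-geometric mean inequality.  With [t / x = exp L] it is the convex
    combination of the bounds of [exp L] and of [exp 0] by the tangent line of exp at [b L]. *)
Lemma powR_le_tangent b x t : 0 <= b <= 1 -> 0 < x -> 0 < t ->
  t `^ b <= x `^ b * (1 - b + b * (t / x)).
Proof.
move=> /andP[b0 b1] x0 t0; have u0 : 0 < t / x by rewrite divr_gt0.
have -> : t = x * (t / x) by rewrite mulrC divfK// gt_eqF.
set u := t / x in u0 *.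
rewrite powRM ?(ltW x0) ?(ltW u0)//; apply: ler_wpM2l; first exact: powR_ge0.
rewrite (_ : x * u / x = u); last by field; rewrite gt_eqF.
have := lnK u0; move: (ln u) => L Lu; rewrite -{}Lu.
rewrite /powR gt_eqF ?expR_gt0// expRK.
(* Tangent lines at [b L], evaluated at [0] and at [L]. *)
have h1 := expR_ge1Dx (- (b * L)).
have h2 := expR_ge1Dx ((1 - b) * L).
have e1 : expR (b * L) * (1 + - (b * L)) <= 1.
  by rewrite -[leRHS](expRxMexpNx_1 (b * L)) ler_wpM2l ?expR_ge0.
have e2 : expR (b * L) * (1 + (1 - b) * L) <= expR L.
  rewrite (_ : expR L = expR (b * L) * expR ((1 - b) * L)) ?ler_wpM2l ?expR_ge0//.
  by rewrite -expRD; congr expR; ring.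
have := ler_wpM2l b0 e2; have := ler_wpM2l (_ : 0 <= 1 - b) e1.
by rewrite subr_ge0 => /(_ b1); nra.
Qed.

(** Integrate [powR_le_tangent] against the Gamma density of parameter [x], whose mean is [x].
    Together with [Gamma_ge_powR] it yields the growth of [Gamma (x + b) / Gamma x]. *)
Lemma Gamma_le_powR b x : 0 <= b <= 1 -> 0 < x -> Gamma (x + b) <= x `^ b * Gamma x.
Proof.
move=> /andP[b0 b1] x0; have xb0 : 0 < x + b by rewrite ltr_wpDr.
have mD : measurable D by exact: measurable_itv.
have ig y : 0 < y -> mu.-integrable D (EFin \o gamma_weight y).
  exact: integrable_gamma_weight.
have -> : x `^ b * Gamma x =
    x `^ b * ((1 - b) * Gamma x + b / x * Gamma (x + 1)).
  by rewrite GammaS//; field; rewrite gt_eqF.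
have i1 : mu.-integrable D (EFin \o (fun t => (1 - b) * gamma_weight x t)).
  exact: (@integrableZl_EFin _ _ _ mu _ D _ mD (ig _ x0)).
have i2 : mu.-integrable D (EFin \o (fun t => b / x * gamma_weight (x + 1) t)).
  exact: (@integrableZl_EFin _ _ _ mu _ D _ mD (ig _ (addr_gt0 x0 ltr01))).
rewrite /Gamma -!RintegralZl//=; last 2 first.
- exact: ig (addr_gt0 x0 ltr01).
- exact: ig.
rewrite -RintegralD//= -RintegralZl//=; last first.
  exact: (@integrableD_EFin _ _ _ mu _ _ D mD i1 i2).
apply: le_Rintegral => //=.
- exact: ig.
- exact: (@integrableZl_EFin _ _ _ mu _ D _ mD (@integrableD_EFin _ _ _ mu _ _ D mD i1 i2)).
move=> t /=; rewrite in_itv/= andbT => t0.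
rewrite (_ : x + b - 1 = (x - 1) + b); last by ring.
rewrite powRD_gt0// (_ : x + 1 - 1 = (x - 1) + 1); last by ring.
rewrite (powRD_gt0 _ 1)// powRr1 ?(ltW t0)//.
have := powR_le_tangent (introT andP (conj b0 b1)) x0 t0 => h.
rewrite [leRHS](_ : _ = t `^ (x - 1) * (x `^ b * (1 - b + b * (t / x))) * expR (- t)).
  by rewrite ler_wpM2r ?expR_ge0// ler_wpM2l ?powR_ge0.
by field; rewrite gt_eqF.
Qed.

(** Apply [Gamma_le_powR] from [x + b] to [x + 1] and use [Gamma (x + 1) = x Gamma x]. *)
Lemma Gamma_ge_powR b x : 0 <= b <= 1 -> 0 < x ->
  x * (x + b) `^ (b - 1) * Gamma x <= Gamma (x + b).
Proof.
move=> /andP[b0 b1] x0; have xb0 : 0 < x + b by rewrite ltr_wpDr.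
have h : Gamma (x + b + (1 - b)) <= (x + b) `^ (1 - b) * Gamma (x + b).
  by apply: Gamma_le_powR => //; rewrite subr_ge0 b1 gerBl b0.
rewrite (_ : x + b + (1 - b) = x + 1) ?GammaS// in h; last by ring.
rewrite -(opprB 1 b) powRN mulrAC ler_pdivrMr ?powR_gt0//.
by rewrite [leRHS]mulrC.
Qed.

(** An integrable bound, uniform for [p] within [e] of [x], that allows the Gamma integral to
    be differentiated under the integral sign. *)
Lemma powR_ln_le_powR p x e t : 0 < e -> x - e < p < x + e -> 0 < t ->
  `|t `^ (p - 1) * ln t| <= (t `^ (x - 2 * e - 1) + t `^ (x + 2 * e - 1)) / e.
Proof.
move=> e0 /andP[p1 p2] t0; rewrite normrM ger0_norm ?powR_ge0//.
have [t1|t1] := leP 1 t.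
  rewrite ger0_norm ?ln_ge0//.
  apply: (@le_trans _ _ (t `^ (x + 2 * e - 1) / e)); last first.
    by rewrite ler_wpM2r ?invr_ge0 ?(ltW e0)// lerDr powR_ge0.
  apply: le_trans (ler_wpM2l (powR_ge0 _ _) (ln_le_powR e0 t0)) _.
  rewrite mulrA -powRD_gt0// ler_wpM2r ?invr_ge0 ?(ltW e0)// ler_powR//; lra.
rewrite ler0_norm ?ln_le0 ?(ltW t1)//.
apply: (@le_trans _ _ (t `^ (x - 2 * e - 1) / e)); last first.
  by rewrite ler_wpM2r ?invr_ge0 ?(ltW e0)// lerDl powR_ge0.
apply: le_trans (ler_wpM2l (powR_ge0 _ _) (Nln_le_powR e0 t0)) _.
rewrite mulrA -powRD_gt0// ler_wpM2r ?invr_ge0 ?(ltW e0)// ger_powR//.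
  by rewrite t0 ltW.
lra.
Qed.

Lemma is_derive_powRr t p : 0 < t -> is_derive p 1 (fun q => t `^ (q - 1)) (t `^ (p - 1) * ln t).
Proof.
move=> t0.
have -> : (fun q => t `^ (q - 1)) = fun q => expR ((q - 1) * ln t).
  by apply/funext => q; rewrite /powR gt_eqF.
apply: is_derive_eq.
by rewrite /GRing.scale/= /powR gt_eqF//; ring.
Qed.

Lemma derivable_Gamma x : 0 < x -> derivable (@Gamma R) x 1.
Proof.
(* The bound of the derivative needs [x - 2 e > 0]. *)
move=> x0; pose e := x / 4; have e0 : 0 < e by rewrite divr_gt0.
have xe : x = 4 * e by rewrite /e; field.
pose G t := e^-1 * gamma_weight (x - 2 * e) t + e^-1 * gamma_weight (x + 2 * e) t.
have d1 (t y : R) : 0 < t -> is_derive y 1 (fun z => gamma_weight z t)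
    (t `^ (y - 1) * ln t * expR (- t)).
  move=> t0; have h := is_derive_powRr y t0.
  by apply: is_derive_eq; rewrite /GRing.scale/=; ring.
apply: (@derivable_under_integral R _ _ mu (@gamma_weight R) D _ x (x - e) (x + e) _ _ _ G).
- exact: measurable_itv.
- by rewrite /= in_itv/=; lra.
- move=> y /=; rewrite in_itv/= => /andP[y1 y2]; apply: integrable_gamma_weight; lra.
- by move=> y t _ /=; rewrite in_itv/= andbT => t0; have [] := d1 t y t0.
- by move=> t; rewrite addr_ge0// mulr_ge0 ?gamma_weight_ge0// invr_ge0 ltW.
- by apply: integrableD_EFin => //; apply: integrableZl_EFin => //;
    apply: integrable_gamma_weight; lra.
- move=> y t /=; rewrite !in_itv/= andbT => yx t0.
  rewrite /partial1of2 derive1E; have [_ ->] := d1 t y t0.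
  rewrite normrM (ger0_norm (expR_ge0 _)).
  have := powR_ln_le_powR e0 yx t0 => h.
  apply: le_trans (ler_wpM2r (expR_ge0 _) h) _.
  by rewrite /G /gamma_weight le_eqVlt; apply/orP; left; apply/eqP; ring.
Qed.

Lemma is_derive_Gamma x : 0 < x -> is_derive x 1 (@Gamma R) (derive1 (@Gamma R) x).
Proof. by move=> x0; rewrite derive1E; exact/derivableP/derivable_Gamma. Qed.

Lemma digammaS x : 0 < x -> digamma (x + 1) = digamma x + x^-1.
Proof.
move=> x0; have G0 := Gamma_gt0 x0.
have E : derive1 (@Gamma R) (x + 1) = Gamma x + x * derive1 (@Gamma R) x.
  have h1 : is_derive x 1 (fun y => Gamma (y + 1)) (derive1 (@Gamma R) (x + 1)).
    have h := is_derive_Gamma (addr_gt0 x0 ltr01).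
    have h' : is_derive x 1 (fun y => y + 1) (1 : R).
      by apply: is_derive_eq; rewrite addr0.
    have := @is_derive1_comp R (@Gamma R) (fun y => y + 1) x _ _ h h'.
    by rewrite mulr1.
  have h2 : is_derive x 1 (fun y => y * Gamma y) (Gamma x + x * derive1 (@Gamma R) x).
    have h := is_derive_Gamma x0.
    have h' := is_deriveM (is_derive_id x (1 : R)) h.
    by apply: (is_derive_eq h'); rewrite /GRing.scale/=; ring.
  have <- := @derive_val _ _ _ _ _ _ _ h1.
  rewrite (@near_eq_derive _ _ _ _ (fun y : R => y * Gamma y)).
  - exact: derive_val.
  - near=> y; apply: GammaS; near: y; exact: lt_nbhsr.
rewrite /digamma E GammaS//; field; rewrite !gt_eqF//.
Unshelve. all: by end_near. Qed.

(** Telescopes the logarithmic derivative of [Gamma (x + 1) = x Gamma x]. *)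
Lemma digamma_addn x n : 0 < x -> digamma (x + n%:R) - digamma x = rising_harmonic x n.
Proof.
move=> x0; elim: n => [|n IH]; first by rewrite addr0 subrr /rising_harmonic big_ord0.
rewrite /rising_harmonic big_ord_recr/= -/(rising_harmonic x n).
rewrite -IH -natr1 addrA digammaS ?ltr_wpDr//.
by rewrite addrAC.
Qed.
End GammaAsymptotics.

(** * Averaging around a cycle *)

Section CyclicAveraging.
Variable R : realType.

Definition cpred (q i : nat) : nat := if i is j.+1 then j else q.

Lemma sum_cpred (q : nat) (f : nat -> R) :
  \sum_(i < q.+1) f (cpred q i) = \sum_(i < q.+1) f i.
Proof. by rewrite big_ord_recl [RHS]big_ord_recr/= addrC. Qed.

Variables (q : nat) (c : nat -> R).
Hypothesis c_gt0 : forall i, 0 < c i.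
Let M := \sum_(i < q.+1) (c i)^-1.

Let M_gt0 : 0 < M.
Proof.
rewrite /M big_ord_recl ltr_pwDl ?invr_gt0// sumr_ge0// => i _.
by rewrite invr_ge0 ltW.
Qed.

(** Poincare inequality on the cycle: a weighted-mean-zero function is bounded by the sum of
    its increments, since each value is an average of its differences with all the others. *)
Lemma cyclic_poincare (w : nat -> R) : \sum_(i < q.+1) w i / c i = 0 ->
  \sum_(i < q.+1) w i ^+ 2 / c i <=
  4 * M * q.+1%:R ^+ 2 * \sum_(i < q.+1) (w (cpred q i) - w i) ^+ 2.
Proof.
move=> w0; set E := \sum_(i < q.+1) (w (cpred q i) - w i) ^+ 2.
have E0 : 0 <= E by apply: sumr_ge0 => i _; exact: sqr_ge0.
(* Each increment is at most the square root of [E], and there are [q + 1] of them. *)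
pose S := q.+1%:R * Num.sqrt E.
have S0 : 0 <= S by rewrite mulr_ge0 ?sqrtr_ge0.
have dE i : (i < q.+1)%N -> `|w (cpred q i) - w i| <= Num.sqrt E.
  move=> iq; rewrite -sqrtr_sqr ler_sqrt// /E (bigD1 (Ordinal iq))//= lerDl.
  by apply: sumr_ge0 => j _; exact: sqr_ge0.
have w0i i : (i < q.+1)%N -> `|w i - w 0%N| <= S.
  move=> iq; apply: (@le_trans _ _ (i%:R * Num.sqrt E)); last first.
    by rewrite ler_wpM2r ?sqrtr_ge0// ler_nat ltnW.
  elim: i iq => [|i IH] iq; first by rewrite subrr normr0 mul0r.
  have -> : w i.+1 - w 0%N = (w i.+1 - w i) + (w i - w 0%N) by ring.
  apply: le_trans (ler_normD _ _) _; rewrite -natr1 mulrDl mul1r addrC.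
  by apply: lerD; [exact/IH/ltnW|rewrite distrC; exact: (dE i.+1)].
have wi i : (i < q.+1)%N -> `|w i| <= 2 * S.
  move=> iq; have -> : w i = M^-1 * \sum_(j < q.+1) (w i - w j) / c j.
    under eq_bigr do rewrite mulrBl.
    rewrite sumrB w0 subr0 -mulr_sumr -/M mulrCA mulVf ?mulr1// gt_eqF//.
  rewrite normrM gtr0_norm ?invr_gt0// mulrC ler_pdivrMr//.
  apply: le_trans (ler_norm_sum _ _ _) _; rewrite /M mulr_sumr.
  apply: ler_sum => j _; rewrite normrM (gtr0_norm (_ : 0 < (c j)^-1)) ?invr_gt0//.
  rewrite ler_wpM2r ?invr_ge0 ?(ltW (c_gt0 _))//.
  have -> : w i - w j = (w i - w 0%N) - (w j - w 0%N) by ring.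
  apply: le_trans (ler_normB _ _) _.
  by rewrite mulr2n mulrDl mul1r lerD// w0i.
apply: (@le_trans _ _ (\sum_(i < q.+1) (2 * S) ^+ 2 / c i)).
  apply: ler_sum => i _; rewrite ler_wpM2r ?invr_ge0 ?(ltW (c_gt0 _))//.
  by rewrite -[leLHS]real_normK ?num_real// lerXn2r ?nnegrE ?mulr_ge0// wi.
rewrite -mulr_sumr -/M /S exprMn exprMn sqr_sqrtr//.
by rewrite le_eqVlt; apply/orP; left; apply/eqP; ring.
Qed.

Variables (th : nat -> R) (v : nat -> nat -> R).
Hypothesis th_gt0 : forall t, 0 < th t.
Hypothesis th_cvg0 : th t @[t --> \oo] --> 0.
Hypothesis th_dvg : \sum_(s < t) th s @[t --> \oo] --> +oo.
Hypothesis vS : forall t i, (i < q.+1)%N ->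
  v t.+1 i = v t i + th t * c i * (v t (cpred q i) - v t i).

Let L := (\sum_(i < q.+1) v 0%N i / c i) / M.

(** The weights [1 / c i] turn the rates [c i] into a flow that is constant around the cycle. *)
Lemma cyclic_mean t : \sum_(i < q.+1) v t i / c i = \sum_(i < q.+1) v 0%N i / c i.
Proof.
elim: t => [//|t <-].
under eq_bigr => i _.
  rewrite vS// (_ : _ / c i = v t i / c i + th t * (v t (cpred q i) - v t i)).
    over.
  by field; rewrite gt_eqF.
rewrite big_split/= -mulr_sumr sumrB sum_cpred subrr mulr0 addr0//.
Qed.

Let w t i := v t i - L.
Let Dt t := \sum_(i < q.+1) w t i ^+ 2 / c i.

Let w_mean t : \sum_(i < q.+1) w t i / c i = 0.
Proof.
under eq_bigr do rewrite mulrBl.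
by rewrite sumrB cyclic_mean -mulr_sumr -/M /L divfK ?subrr// gt_eqF.
Qed.

Let D_ge0 t : 0 <= Dt t.
Proof.
by apply: sumr_ge0 => i _; rewrite mulr_ge0 ?sqr_ge0// invr_ge0 ltW.
Qed.

Let kap := (8 * M * q.+1%:R ^+ 2)^-1.

Let kap_gt0 : 0 < kap.
Proof. by rewrite invr_gt0 !mulr_gt0// exprn_gt0. Qed.

(** Lyapunov function: [2 w d = (w + d) ^ 2 - w ^ 2 - d ^ 2], summed around the cycle, leaves
    the dissipation [- sum d ^ 2], which dominates the second order term for small steps and
    controls the function itself by [cyclic_poincare]. *)
Lemma cyclic_decay t : (forall i, (i < q.+1)%N -> th t * c i <= 2^-1) ->
  Dt t.+1 <= (1 - kap * th t) * Dt t.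
Proof.
move=> tc; pose d i := w t (cpred q i) - w t i.
pose E := \sum_(i < q.+1) d i ^+ 2.
have -> : Dt t.+1 = Dt t - th t * E + th t ^+ 2 * \sum_(i < q.+1) c i * d i ^+ 2.
  have -> : th t * E = \sum_(i < q.+1) (th t * d i ^+ 2 -
      th t * (w t (cpred q i) ^+ 2 - w t i ^+ 2)).
    rewrite sumrB -!mulr_sumr sumrB (sum_cpred q (fun i => w t i ^+ 2)).
    by rewrite subrr mulr0 subr0.
  rewrite mulr_sumr -sumrB -big_split/=; apply: eq_bigr => i _.
  rewrite /d /w vS//; field; rewrite gt_eqF//.
have h1 : th t ^+ 2 * \sum_(i < q.+1) c i * d i ^+ 2 <= th t / 2 * E.
  rewrite !mulr_sumr; apply: ler_sum => i _.
  rewrite mulrA ler_wpM2r ?sqr_ge0// expr2 -mulrA ler_wpM2l ?(ltW (th_gt0 _))//.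
  exact: tc.
have h2 : 2 * kap * Dt t <= E.
  have := cyclic_poincare (w_mean t); rewrite -/(Dt t) -/E => h.
  rewrite (_ : 2 * kap = (4 * M * q.+1%:R ^+ 2)^-1); last first.
    rewrite /kap (_ : 8 * M * _ = 2 * (4 * M * q.+1%:R ^+ 2)); last by ring.
    by rewrite invfM mulrA mulfV ?mul1r.
  by rewrite mulrC ler_pdivrMr 1?mulrC// !mulr_gt0// exprn_gt0.
apply: (@le_trans _ _ (Dt t - th t / 2 * E)).
  by rewrite -addrA lerD2l; apply: le_trans (lerD (lexx _) h1) _; rewrite -mulrN; nra.
rewrite mulrBl mul1r lerD2l lerN2.
have := ler_wpM2l (ltW (th_gt0 t)) h2; nra.
Qed.

(** The Lyapunov function of [cyclic_decay] is eventually at most a multiple of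
    [exp (- kap * sum th)], which tends to [0]. *)
Lemma cyclic_averaging i : (i < q.+1)%N -> v t i @[t --> \oo] --> L.
Proof.
move=> iq.
pose C := \sum_(j < q.+1) c j.
have C0 : 0 < C.
  by rewrite /C big_ord_recl ltr_pwDl ?c_gt0// sumr_ge0// => j _; rewrite ltW.
have cC j : (j < q.+1)%N -> c j <= C.
  move=> jq; rewrite /C (bigD1 (Ordinal jq))//= lerDl.
  by apply: sumr_ge0 => l _; rewrite ltW.
(* The decay estimate holds once the steps are small. *)
have [t0 _ ht0] : \forall t \near \oo, th t * C <= 2^-1.
  have e0 : 0 < (2 * C)^-1 by rewrite invr_gt0 mulr_gt0.
  move/cvgrPdist_le : th_cvg0 => /(_ _ e0); apply: filterS => t.
  rewrite sub0r normrN gtr0_norm// => h.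
  by rewrite -ler_pdivlMr// -invfM.
have decay t : Dt (t0 + t) <=
    expR (- (kap * \sum_(s < t) th (t0 + s)%N)) * Dt t0.
  elim: t => [|t IH]; first by rewrite addn0 big_ord0 mulr0 oppr0 expR0 mul1r.
  rewrite addnS; apply: le_trans (cyclic_decay _) _.
    move=> j jq; apply: le_trans (ht0 (t0 + t)%N _); last by rewrite /= leq_addr.
    by rewrite ler_wpM2l ?cC// ltW.
  have h : 1 - kap * th (t0 + t)%N <= expR (- (kap * th (t0 + t)%N)).
    exact: expR_ge1Dx.
  apply: le_trans (ler_wpM2r (D_ge0 _) h) _.
  apply: le_trans (ler_wpM2l (expR_ge0 _) IH) _.
  by rewrite mulrA -expRD big_ord_recr/= mulrDr opprD addrC.
have sum_shift t : \sum_(s < t) th (t0 + s)%N =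
    \sum_(s < t0 + t) th s - \sum_(s < t0) th s.
  by rewrite big_split_ord/= addrAC subrr add0r.
have dvg : kap * \sum_(s < t) th (t0 + s)%N @[t --> \oo] --> +oo.
  apply/cvgryPge => A.
  have /cvgryPge/(_ (kap^-1 * A + \sum_(s < t0) th s))[N _ hN] := th_dvg.
  exists N => // t /= Nt; rewrite sum_shift -ler_pdivrMl// lerBrDr.
  by apply: hN => /=; rewrite (leq_trans Nt)// leq_addl.
have D0 : Dt (t0 + t)%N @[t --> \oo] --> 0.
  apply: (@squeeze_cvgr _ _ _ _ (cst 0) (fun t =>
      expR (- (kap * \sum_(s < t) th (t0 + s)%N)) * Dt t0)).
  - by apply: nearW => t; rewrite D_ge0 decay.
  - exact: cvg_cst.
  - rewrite -[X in _ --> X](mul0r (Dt t0)); apply: cvgM; last exact: cvg_cst.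
    exact: (cvg_comp _ _ dvg (@cvgr_expR R)).
have {}D0 : Dt t @[t --> \oo] --> 0.
  rewrite -(@cvg_shiftn t0 _ Dt); under eq_fun do rewrite addnC.
  exact: D0.
apply/cvgrPdist_le => e e0.
have e2 : 0 < e ^+ 2 / c i by rewrite divr_gt0// exprn_gt0.
move/cvgrPdist_le : D0 => /(_ _ e2); apply: filterS => t.
rewrite sub0r normrN ger0_norm// ler_pdivlMr// => h.
rewrite distrC -(ler_pXn2r (_ : (0 < 2)%N)) ?nnegrE ?(ltW e0)// real_normK ?num_real//.
apply: le_trans h; rewrite /Dt (bigD1 (Ordinal iq))//= mulrDl divfK ?gt_eqF//.
rewrite lerDl mulr_ge0 ?(ltW (c_gt0 _))//.
by apply: sumr_ge0 => j _; rewrite mulr_ge0 ?sqr_ge0// invr_ge0 ltW.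
Qed.
End CyclicAveraging.

(** * Explicit solution of the beta-binomial recursion *)

Section PhaseRecursion.
Variable R : realType.
Variables (a b : R) (q k : nat).
Hypotheses (a_gt0 : 0 < a) (b_ge0 : 0 <= b).
Let al := a + b.
Let al_gt0 : 0 < al. Proof. exact: ltr_wpDr. Qed.

(** When [q <= k], [phase t i] is the probability that the phase walk, about to visit level
    [k + t] with phase [i] to be completed next, completes phase [0] exactly at level [k].  For
    smaller [k] the same recursion is used although its coefficients may exceed [1]. *)
Fixpoint phase (t i : nat) : R :=
  if t is u.+1 then
    phase u i + (al + (k + u.+1)%:R)^-1 * (al + i%:R) *
      (phase u (cpred q i) - phase u i)
  else if i == 0%N then al / (al + k%:R) else 0.

Lemma phase_small t i : (t < i <= q)%N -> phase t i = 0.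
Proof.
elim: t i => [|t IH] [|i]//= /andP[ti iq].
by rewrite !IH ?(ltnW ti) ?(ltnW iq)// ?andbT ?subrr ?mulr0 ?addr0.
Qed.

Lemma addr_natr_gt0 (x : R) n : 0 < x -> 0 < x + n%:R.
Proof. by move=> x0; rewrite ltr_wpDr. Qed.

(** The initial phase vector has the single entry [al / (al + k)], so the conserved average is
    [1 / ((al + k) M)] with [M] the sum of the weights. *)
Lemma phase_cvg : phase t q @[t --> \oo] -->
  ((al + k%:R) * rising_harmonic al q.+1)^-1.
Proof.
have th0 t : 0 < (al + (k + t.+1)%:R)^-1 :> R by rewrite invr_gt0 addr_natr_gt0.
have -> : ((al + k%:R) * rising_harmonic al q.+1)^-1 =
    (\sum_(i < q.+1) phase 0 i / (al + i%:R)) / \sum_(i < q.+1) (al + i%:R)^-1.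
  rewrite invfM; congr (_ * _).
  rewrite big_ord_recl/= big1 ?addr0 => [|i _]; last by rewrite mul0r.
  by field; rewrite !gt_eqF// addr_natr_gt0.
apply: (@cyclic_averaging R q (fun i => al + i%:R) _
  (fun t => (al + (k + t.+1)%:R)^-1)) => //.
- by move=> i; exact: addr_natr_gt0.
- apply: (@squeeze_cvgr _ _ _ _ (cst 0) (@harmonic R)).
  + apply: nearW => t; rewrite (ltW (th0 t))/= lef_pV2 ?posrE ?addr_natr_gt0//.
    by rewrite -[leLHS]add0r lerD ?(ltW al_gt0)// ler_nat leq_addl.
  + exact: cvg_cst.
  + exact: cvg_harmonic.
- pose C : R := al + (k + 1)%:R.
  have C1 : 1 <= C by rewrite /C natrD addrA lerDr ltW// addr_natr_gt0.
  have hC t : C^-1 * harmonic t <= (al + (k + t.+1)%:R)^-1.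
    rewrite /harmonic/= -invfM lef_pV2 ?posrE ?addr_natr_gt0//; last first.
      by rewrite mulr_gt0// (lt_le_trans ltr01 C1).
    rewrite /C !natrD -[t.+1%:R]natr1.
    have := addr_natr_gt0 k al_gt0; have : 0 <= t%:R :> R by [].
    nra.
  apply/cvgryPge => A.
  have nd : nondecreasing_seq (series (@harmonic R)).
    by apply/nondecreasing_seqP => n; rewrite seriesSr lerDl harmonic_ge0.
  have /cvgryPge/(_ (C * A))[N _ hN] := nondecreasing_dvgn_lt nd (@dvg_harmonic R).
  have C0 : 0 < C by rewrite (lt_le_trans ltr01 C1).
  exists N => // n /= /hN; rewrite -ler_pdivlMl// => h; apply: le_trans h _.
  rewrite /series/= big_mkord mulr_sumr; apply: ler_sum => t _; exact: hC.
Qed.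

(** The reciprocal factorial of [n - m], with the value [0] that the Gamma function dictates
    when [n < m]; this makes the formulas below hold for all levels. *)
Definition ifact (n m : nat) : R := if (m <= n)%N then ((n - m)`!%:R)^-1 else 0.

Lemma ifactS n m : ifact n.+1 m.+1 = ifact n m.
Proof. by rewrite /ifact ltnS subSS. Qed.

Lemma ifact_mul n m : ifact n.+1 m * (n.+1%:R - m%:R) = ifact n m.
Proof.
rewrite /ifact; case: (leqP m n) => [mn|].
  rewrite leqW// subSn// factS natrM -natrB ?leqW// subSn//.
  by rewrite invfM mulrAC mulVf ?mul1r.
rewrite leq_eqVlt => /predU1P[<-|nm]; first by rewrite subrr mulr0.
by rewrite leqNgt nm mul0r.
Qed.

Let kap := rising a k / rising al k.

(** The harmonic function [rising al n / rising a n], normalised at [k], times the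
    probability that the phase walk started just below level [n] hits [k]. *)
Definition euler_sol (n : nat) : R :=
  if (n < k)%N then 0 else if n == k then 1 else
  kap * (rising al n / rising a n) * phase (n - k).-1 q.

Lemma euler_sol_gt t : euler_sol (k + t.+1) =
  kap * (rising al (k + t.+1) / rising a (k + t.+1)) * phase t q.
Proof.
rewrite /euler_sol ltnNge leq_addr/= (_ : (k + t.+1 == k)%N = false) ?addKn//.
by apply/eqP; lia.
Qed.

Let G (n : nat) : R := rising a n / n`!%:R * euler_sol n.
Let S (i n : nat) : R := \sum_(j < n) 'C(n.-1 - j, i)%:R * G j.

Let rising_neq0 (x : R) n : 0 < x -> rising x n != 0.
Proof. by move=> x0; rewrite gt_eqF// rising_gt0. Qed.

Let fact_neq0 n : n`!%:R != 0 :> R.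
Proof. by rewrite pnatr_eq0 -lt0n fact_gt0. Qed.

Let G_gt t : G (k + t.+1) = kap * (rising al (k + t.+1) * ifact (k + t.+1) 0) * phase t q.
Proof.
rewrite /G euler_sol_gt /ifact/= subn0.
field; rewrite fact_neq0 rising_neq0//.
Qed.

Let SS0 n : S 0 n.+1 = S 0 n + G n.
Proof.
by rewrite /S big_ord_recr/= subnn bin0 mul1r; congr (_ + _); apply: eq_bigr => j _; rewrite !bin0.
Qed.

Let SSS i n : S i.+1 n.+1 = S i.+1 n + S i n.
Proof.
rewrite /S big_ord_recr/= subnn bin0n/= mul0r addr0 -big_split/=.
apply: eq_bigr => -[j /= jn] _; rewrite -mulrDl -natrD.
by case: n jn => // n jn; rewrite /= subSn// binS.
Qed.

Let S_phase t i : (i <= q)%N ->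
  S i (k + t.+1) = kap * (rising al (k + t.+1) / rising al i.+1 *
    ifact (k + t.+1) i.+1) * phase t i.
Proof.
elim: t i => [|t IH] i iq.
  rewrite addn1 /S big_ord_recr/= subnn bin0n big1 ?add0r; last first.
    by move=> j _; rewrite /G /euler_sol ltn_ord !mulr0.
  rewrite /G /euler_sol ltnn eqxx mulr1; case: i iq => [|i] iq; last by rewrite mul0r mulr0.
  rewrite mul1r /kap risingSr ifactS /ifact/= subn0 (risingSr al 0) rising0 addr0.
  by field; rewrite !gt_eqF ?rising_gt0 ?addr_natr_gt0.
set n := (k + t.+1)%N in IH *.
have n1 : al + n%:R != 0 by rewrite gt_eqF// addr_natr_gt0.
have A0 := rising_neq0 n al_gt0; have al0 : al != 0 by rewrite gt_eqF.
rewrite addnS -/n ifactS [phase t.+1 i]/= (risingSr al n).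
have IF j : ifact n j.+1 = ifact n j * (n%:R - j%:R).
  by rewrite -[in LHS]ifact_mul ifactS -!natr1; congr (_ * _); ring.
case: i iq => [|i] iq.
  rewrite SS0 IH// /n G_gt -/n /= addr0 IF risingSr rising0 addr0.
  by field; rewrite n1 al0.
have al1 : al + i.+1%:R != 0 by rewrite gt_eqF// addr_natr_gt0.
have B0 := rising_neq0 i.+1 al_gt0.
rewrite SSS IH// IH 1?ltnW// [cpred q i.+1]/= IF (risingSr al i.+1).
rewrite -/n; move: i.+1%:R al1 => x al1; field.
by rewrite n1 al1 B0.
Qed.

(** When [al] and [a] are related by [rising_malthusian], [b] times the beta-binomial weight of
    [j], in a form in which the sum over [j] is a convolution with a binomial coefficient. *)
Definition euler_kernel (n j : nat) : R :=
  rising al q.+1 * ((n - q.+1)`!%:R / rising a n) * 'C(n.-1 - j, q)%:R *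
  (rising a j / j`!%:R).

(** The convolution with the binomial coefficient is an iterated sum.  Its intermediate sums
    [S i n] obey Pascal's rule, and after normalisation this rule is the recursion of [phase]. *)
Lemma euler_sol_rec n : (k < n)%N -> (q < n)%N ->
  euler_sol n = \sum_(j < n) euler_kernel n j * euler_sol j.
Proof.
move=> kn qn.
have -> : \sum_(j < n) euler_kernel n j * euler_sol j =
    rising al q.+1 * ((n - q.+1)`!%:R / rising a n) * S q n.
  rewrite /S mulr_sumr; apply: eq_bigr => j _.
  by rewrite /euler_kernel /G !mulrA.
have nE : n = (k + (n - k).-1.+1)%N by rewrite prednK ?subn_gt0// subnKC// ltnW.
have -> : S q n = kap * (rising al n / rising al q.+1 * ifact n q.+1) *
    phase (n - k).-1 q by rewrite nE S_phase// -nE.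
rewrite /euler_sol ltnNge (ltnW kn)/= gt_eqF// /ifact qn.
have f0 : (n - q.+1)`!%:R != 0 :> R by rewrite pnatr_eq0 -lt0n fact_gt0.
by field; rewrite ?f0 ?rising_neq0.
Qed.

(** The walk needs at least [q + 1] steps to go around the cycle.  So the recursion is also
    consistent with the levels just above [k] where no splitting takes place. *)
Lemma euler_sol0 n : (k < n)%N -> (n <= q + k)%N -> euler_sol n = 0.
Proof.
move=> kn nq; rewrite /euler_sol ltnNge (ltnW kn)/= gt_eqF//.
by rewrite phase_small ?mulr0// leqnn andbT; lia.
Qed.

Lemma euler_sol_lt n : (n < k)%N -> euler_sol n = 0.
Proof. by rewrite /euler_sol => ->. Qed.

Lemma euler_sol_id : euler_sol k = 1.
Proof. by rewrite /euler_sol ltnn eqxx. Qed.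

End PhaseRecursion.

Section EulerAsymptotics.
Variable R : realType.

Lemma rising_Gamma (x : R) n : 0 < x -> rising x n = Gamma (x + n%:R) / Gamma x.
Proof.
move=> x0; elim: n => [|n IH].
  by rewrite rising0 addr0 divff// gt_eqF// Gamma_gt0.
by rewrite risingSr IH -natr1 addrA GammaS ?addr_natr_gt0//; ring.
Qed.

Lemma powR_nat_cvg1 (b x : R) (m : nat) : 0 <= b -> 0 < x ->
  (x + n%:R) `^ b / (n + m)%:R `^ b @[n --> \oo] --> (1 : R).
Proof.
move=> b0 x0.
have cvg1 : (x + n%:R) / (n + m)%:R @[n --> \oo] --> (1 : R).
  rewrite [X in _ --> X](_ : 1 = 1 + (x - m%:R) * 0); last by rewrite mulr0 addr0.
  rewrite -cvg_shiftS/=.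
  have -> : (fun n => (x + n.+1%:R) / (n.+1 + m)%:R) =
      fun n => 1 + (x - m%:R) * @harmonic R (n + m)%N.
    apply/funext => n; rewrite /harmonic/= addSn.
    have h : (n + m).+1%:R != 0 :> R by rewrite pnatr_eq0.
    have e : (n + m).+1%:R = n.+1%:R + m%:R :> R by rewrite -addSn natrD.
    by rewrite e in h *; field.
  apply: cvgD; first exact: cvg_cst.
  apply: cvgM; first exact: cvg_cst.
  by rewrite (@cvg_shiftn m R (@harmonic R)); exact: cvg_harmonic.
have := cvg_comp _ _ cvg1 (continuous_powR_gt0 (p := b) ltr01).
rewrite powR1; apply: cvg_trans; apply: near_eq_cvg; near=> n.
have n0 : (0 < n)%N by near: n; exact: nbhs_infty_gt.
rewrite /= powRM ?invr_ge0 ?(ltW (addr_natr_gt0 _ _))//.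
by rewrite -[(n + m)%:R^-1]powR_inv1// -powRrM mulN1r powRN.
Unshelve. all: by end_near. Qed.

Lemma Gamma_ratio_cvg (b x : R) (m : nat) : 0 <= b <= 1 -> 0 < x ->
  Gamma (x + b + n%:R) / Gamma (x + n%:R) / (n + m)%:R `^ b @[n --> \oo] --> (1 : R).
Proof.
move=> /andP[b0 b1] x0; have xb0 : 0 < x + b by rewrite ltr_wpDr.
apply: (@squeeze_cvgr _ _ _ _
  (fun n => (x + n%:R) / (x + b + n%:R) * ((x + b + n%:R) `^ b / (n + m)%:R `^ b))
  (fun n => (x + n%:R) `^ b / (n + m)%:R `^ b)).
- apply: nearW => n.
  have xn := addr_natr_gt0 n x0; have xbn := addr_natr_gt0 n xb0.
  have G0 := Gamma_gt0 xn.
  have b01 : 0 <= b <= 1 by rewrite b0.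
  have eb : x + n%:R + b = x + b + n%:R by ring.
  apply/andP; split.
    rewrite mulrA ler_wpM2r ?invr_ge0 ?powR_ge0//.
    rewrite ler_pdivlMr// -eb; apply: le_trans (Gamma_ge_powR b01 xn).
    rewrite eb -!mulrA ler_wpM2l ?(ltW xn)// mulrA ler_wpM2r ?(ltW G0)//.
    by rewrite (powRSr b xbn) mulKf// gt_eqF.
  rewrite ler_wpM2r ?invr_ge0 ?powR_ge0// ler_pdivrMr// -eb.
  exact: Gamma_le_powR.
- rewrite -[X in _ --> X]mulr1; apply: cvgM; last exact: powR_nat_cvg1.
  rewrite [X in _ --> X](_ : 1 = 1 - b * 0); last by rewrite mulr0 subr0.
  have -> : (fun n => (x + n%:R) / (x + b + n%:R)) =
      fun n => 1 - b * (x + b + n%:R)^-1.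
    by apply/funext => n; field; rewrite gt_eqF// addr_natr_gt0.
  apply: cvgB; first exact: cvg_cst.
  apply: cvgM; first exact: cvg_cst.
  rewrite -cvg_shiftS/=.
  apply: (@squeeze_cvgr _ _ _ _ (cst 0) (@harmonic R)).
  + apply: nearW => n /=; rewrite invr_ge0 (ltW (addr_natr_gt0 _ _))//=.
    by rewrite lef_pV2 ?posrE ?addr_natr_gt0// lerDr ltW.
  + exact: cvg_cst.
  + exact: cvg_harmonic.
- exact: powR_nat_cvg1.
Unshelve. all: by end_near. Qed.

Lemma euler_sol_cvg (a b : R) (q k m : nat) : 0 < a -> 0 <= b <= 1 ->
  euler_sol a b q k n / (n + m)%:R `^ b @[n --> \oo] -->
  Gamma (a + k%:R) / (rising_harmonic (a + b) q.+1 * Gamma (a + b + k%:R + 1)).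
Proof.
move=> a0 /andP[b0 b1]; have al0 : 0 < a + b by rewrite ltr_wpDr.
have ak := addr_natr_gt0 k a0; have alk := addr_natr_gt0 k al0.
have H0 : 0 < rising_harmonic (a + b) q.+1.
  rewrite /rising_harmonic big_ord_recl ltr_pwDl ?invr_gt0 ?addr_natr_gt0// sumr_ge0// => i _.
  by rewrite invr_ge0 ltW// addr_natr_gt0.
rewrite GammaS//.
have -> : Gamma (a + k%:R) /
      (rising_harmonic (a + b) q.+1 * ((a + b + k%:R) * Gamma (a + b + k%:R))) =
    Gamma (a + k%:R) / Gamma (a + b + k%:R) *
      (1 * ((a + b + k%:R) * rising_harmonic (a + b) q.+1)^-1).
  by field; rewrite !gt_eqF// Gamma_gt0.
rewrite -(cvg_shiftn k.+1)/=.
have -> : (fun n => euler_sol a b q k (n + k.+1) / (n + k.+1 + m)%:R `^ b) =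
  fun n => Gamma (a + k%:R) / Gamma (a + b + k%:R) *
   (Gamma (a + b + (n + k.+1)%:R) / Gamma (a + (n + k.+1)%:R) / (n + k.+1 + m)%:R `^ b *
     phase a b q k n q).
  apply/funext => n.
  rewrite (_ : (n + k.+1)%N = (k + n.+1)%N); last by rewrite !addnS addnC.
  rewrite euler_sol_gt// !rising_Gamma//.
  have p0 : 0 < (k + n.+1 + m)%:R `^ b by rewrite powR_gt0// ltr0n addnS.
  field; rewrite !gt_eqF ?Gamma_gt0 ?addr_natr_gt0//.
apply: cvgM; first exact: cvg_cst.
apply: cvgM; last exact: phase_cvg.
have h := @Gamma_ratio_cvg b a m (introT andP (conj b0 b1)) a0.
rewrite -(cvg_shiftn k.+1)/= in h; exact: h.
Qed.
End EulerAsymptotics.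

(** * Marginals of the multinomial distribution *)

Section MultinomialMarginals.
Variable R : realType.

(** The multinomial weights are coefficients of products of these truncated exponentials. *)
Definition texp (m : nat) (p : R) : {poly R} := \poly_(j < m.+1) (p ^+ j / j`!%:R).

Let fact_neq0 n : n`!%:R != 0 :> R.
Proof. by rewrite pnatr_eq0 -lt0n fact_gt0. Qed.

(** Below the truncation degree a product of exponentials is the exponential of the sum; the
    induction step is the binomial theorem. *)
Lemma coef_prod_texp (I : Type) (s : seq I) (p : I -> R) (Q : pred I) m n : (n <= m)%N ->
  (\prod_(i <- s | Q i) texp m (p i))`_n = (\sum_(i <- s | Q i) p i) ^+ n / n`!%:R.
Proof.
elim: s n => [|i s IH] n nm.
  by rewrite !big_nil coef1; case: n nm => [|n] _; rewrite ?expr0 ?fact0 ?divr1// expr0n mul0r.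
rewrite !big_cons; case: ifP => _; last exact: IH.
rewrite coefM exprDn mulr_suml; under [RHS]eq_bigr do rewrite -mulr_natr.
rewrite [RHS](reindex_inj rev_ord_inj)/=; apply: eq_bigr => j _.
have jn : (j <= n)%N by rewrite -ltnS.
rewrite coef_poly ltnS (leq_trans jn nm) IH ?(leq_trans (leq_subr _ _) nm)//.
rewrite subSS subKn// bin_sub// -(bin_fact jn) !natrM.
by field; rewrite !fact_neq0 pnatr_eq0 -lt0n bin_gt0 jn.
Qed.

(** Expands the product of polynomials; all the sums over outcomes follow by choosing [f]. *)
Lemma sum_mult_pmf_weight (r m : nat) (p : r.-tuple R) (f : 'I_r -> nat -> R) :
  \sum_(x : {ffun 'I_r -> 'I_m.+1})
    (\prod_(i < r) f i (x i)) * mult_pmf m p (fun i => x i : nat) =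
  m`!%:R * (\prod_(i < r) \poly_(j < m.+1) (f i j * (tnth p i ^+ j / j`!%:R)))`_m.
Proof.
under [in RHS]eq_bigr do rewrite poly_def.
rewrite bigA_distr_bigA coef_sum mulr_sumr; apply: eq_bigr => x _.
under [in RHS]eq_bigr do rewrite -mul_polyC.
rewrite big_split/= -(big_morph _ (@polyCM R) (erefl _)) prodrXr coefCM coefXn.
rewrite /mult_pmf eq_sym; case: ifP => _; last by rewrite !mulr0.
by rewrite mulr1 !big_split/= prodfV; field; apply/prodf_neq0 => i _.
Qed.

Lemma sum_mult_pmf (r m : nat) (p : r.-tuple R) :
  \sum_(x : {ffun 'I_r -> 'I_m.+1}) mult_pmf m p (fun i => x i : nat) =
  (\sum_(i < r) tnth p i) ^+ m.
Proof.
transitivity (\sum_(x : {ffun 'I_r -> 'I_m.+1})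
    (\prod_(i < r) (fun _ _ => 1) i (x i)) * mult_pmf m p (fun i => x i : nat)).
  by apply: eq_bigr => x _; rewrite big1 ?mul1r.
rewrite (@sum_mult_pmf_weight _ _ _ (fun _ _ => 1)).
under eq_bigr do under eq_poly do rewrite mul1r.
by rewrite (@coef_prod_texp _ _ (tnth p) _ m m)// mulrC divfK.
Qed.

Lemma sum_mult_pmf_marginal (r m : nat) (p : r.-tuple R) (i0 : 'I_r) (j : nat) :
  \sum_(x : {ffun 'I_r -> 'I_m.+1} | (x i0 == j :> nat)) mult_pmf m p (fun i => x i : nat) =
  if (j <= m)%N then
    'C(m, j)%:R * tnth p i0 ^+ j * (\sum_(i < r | i != i0) tnth p i) ^+ (m - j) else 0.
Proof.
pose f (i : 'I_r) (l : nat) : R := if i == i0 then (l == j)%:R else 1.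
transitivity (\sum_(x : {ffun 'I_r -> 'I_m.+1})
    (\prod_(i < r) f i (x i)) * mult_pmf m p (fun i => x i : nat)).
  rewrite big_mkcond; apply: eq_bigr => x _; rewrite (bigD1 i0)//= big1 => [|i ii0].
    by rewrite mulr1 /f eqxx; case: eqP; rewrite ?mul1r ?mul0r.
  by rewrite /f (negbTE ii0).
rewrite sum_mult_pmf_weight (bigD1 i0)//=.
have -> : \prod_(i < r | i != i0) \poly_(l < m.+1) (f i l * (tnth p i ^+ l / l`!%:R)) =
    \prod_(i < r | i != i0) texp m (tnth p i).
  apply: eq_bigr => i ii0; apply: eq_poly => l _.
  by rewrite /f (negbTE ii0) mul1r.
rewrite coefM; case: leqP => jm; last first.
  rewrite big1 ?mulr0// => l _; rewrite coef_poly ltnS -ltnS ltn_ord /f eqxx.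
  by rewrite ltn_eqF ?mul0r// (leq_ltn_trans _ jm)// -ltnS.
have jm' : (j < m.+1)%N by [].
rewrite (bigD1 (Ordinal jm'))//= [X in _ + X]big1 ?addr0 => [|l lj]; last first.
  rewrite coef_poly ltn_ord /f eqxx (_ : (l == j :> nat) = false) ?mul0r//.
  by apply: contraNF lj => /eqP lj; apply/eqP/val_inj.
rewrite coef_poly jm' coef_prod_texp ?leq_subr// /f !eqxx mul1r -(bin_fact jm) !natrM.
by field; rewrite !fact_neq0.
Qed.

End MultinomialMarginals.

Section ChildrenPmf.
Variables (R : realType) (b s1 : nat).
Implicit Types (v : b.-tuple R).

Let full v : b.+1.-tuple R := [tuple of rcons v (1 - \sum_(i < b) tnth v i)].

Lemma tnth_full_lift v i : tnth (full v) (lift ord_max i) = tnth v i.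
Proof.
by rewrite !(tnth_nth 0)/= /bump leqNgt ltn_ord add0n nth_rcons size_tuple ltn_ord.
Qed.

Lemma tnth_full_max v : tnth (full v) ord_max = 1 - \sum_(i < b) tnth v i.
Proof. by rewrite (tnth_nth 0)/= nth_rcons size_tuple ltnn eqxx. Qed.

Lemma sum_full v : \sum_(i < b.+1) tnth (full v) i = 1.
Proof.
rewrite big_ord_recr/= tnth_full_max.
under eq_bigr => i _.
  rewrite (_ : widen_ord _ i = lift ord_max i); last first.
    by apply/val_inj; rewrite /= /bump leqNgt ltn_ord.
  rewrite tnth_full_lift; over.
by rewrite subrKC.
Qed.

Lemma children_pmf_ge0 m v (c : 'I_b -> nat) :
  (forall i, 0 <= tnth v i) -> \sum_(i < b) tnth v i <= 1 -> 0 <= children_pmf s1 m v c.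
Proof.
move=> v0 v1; apply: sumr_ge0 => x _; rewrite /mult_pmf; case: ifP => // _.
rewrite mulr_ge0 ?divr_ge0 ?prodr_ge0// => i _; apply: exprn_ge0.
case: (unliftP ord_max i) => [j|] ->; first by rewrite tnth_full_lift.
by rewrite tnth_full_max subr_ge0.
Qed.

Definition shifted m (y : {ffun 'I_b -> 'I_m.+1}) : 'I_b -> nat := fun i => (y i + s1)%N.

Let restr m (x : {ffun 'I_b.+1 -> 'I_m.+1}) : {ffun 'I_b -> 'I_m.+1} :=
  [ffun i => x (lift ord_max i)].

(** Groups the outcomes of the [b + 1] boxes by their first [b] counts. *)
Lemma sum_children_pmf m v (Q : pred {ffun 'I_b -> 'I_m.+1}) :
  \sum_(y : {ffun 'I_b -> 'I_m.+1} | Q y) children_pmf s1 m v (shifted y) =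
  \sum_(x : {ffun 'I_b.+1 -> 'I_m.+1} | Q (restr x)) mult_pmf m (full v) (fun i => x i : nat).
Proof.
rewrite [RHS](partition_big (@restr m) Q)//; apply: eq_bigr => y Qy.
apply: eq_bigl => x; apply/forallP/andP => [h|[_ /eqP <-] i]; last first.
  by rewrite /shifted ffunE.
have xy : restr x = y.
  by apply/ffunP => i; rewrite ffunE; apply/val_inj/eqP; rewrite -(eqn_add2r s1) h.
by rewrite xy.
Qed.

Lemma sum_children_pmf1 m v :
  \sum_(y : {ffun 'I_b -> 'I_m.+1}) children_pmf s1 m v (shifted y) = 1.
Proof. by rewrite sum_children_pmf sum_mult_pmf sum_full expr1n. Qed.

(** The law of [s1 + Bin (m, t)]. *)
Definition bin_pmf m j (t : R) : R :=
  if (s1 <= j <= s1 + m)%N then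
    'C(m, j - s1)%:R * t ^+ (j - s1) * (1 - t) ^+ (m - (j - s1)) else 0.

Lemma sum_children_pmf_marginal m v i j :
  \sum_(y : {ffun 'I_b -> 'I_m.+1} | shifted y i == j) children_pmf s1 m v (shifted y) =
  bin_pmf m j (tnth v i).
Proof.
rewrite (@sum_children_pmf m v (fun y => shifted y i == j)) /bin_pmf.
case: leqP => s1j /=; last first.
  rewrite big1// => x /eqP; rewrite /shifted => h.
  by move: s1j; rewrite -h ltnNge leq_addl.
rewrite -leq_subLR.
have := sum_mult_pmf_marginal m (full v) (lift ord_max i) (j - s1).
rewrite (_ : \sum_(i0 | i0 != _) _ = 1 - tnth v i); last first.
  by rewrite -(sum_full v) [in RHS](bigD1 (lift ord_max i))//= tnth_full_lift addrAC subrr add0r.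
rewrite tnth_full_lift => <-; apply: eq_bigl => x.
by rewrite /shifted ffunE -[in RHS](eqn_add2r s1) subnK.
Qed.
End ChildrenPmf.

(** * Image measures with densities and independent events *)

Section IntegralTransfer.
Context d d' (T : measurableType d) (T' : measurableType d') (R : realType).
Variables (mu : {measure set T -> \bar R}) (m : {measure set T' -> \bar R}).
Variables (X : T -> T') (g : T -> R).
Hypotheses (mX : measurable_fun setT X) (mg : measurable_fun setT g).
Hypothesis g_ge0 : forall x, 0 <= g x.
Hypothesis mE : forall A, measurable A ->
  m A = (\int[mu]_(x in X @^-1` A) (g x)%:E)%E.

Import HBNNSimple.

(** Covers at once image measures ([g = 1]), measures with a density ([X = id]) and the
    restriction to an independent event ([g] an indicator). *)
Lemma ge0_integral_transfer (f : T' -> R) : measurable_fun setT f ->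
  (forall y, 0 <= f y) ->
  (\int[m]_y (f y)%:E = \int[mu]_x (f (X x) * g x)%:E)%E.
Proof.
move=> mf f0.
have mfE : measurable_fun setT (EFin \o f) by exact/measurable_EFinP.
pose h := nnsfun_approx measurableT mfE.
have hf x : (EFin \o h n) x @[n --> \oo] --> (f x)%:E.
  by apply: cvg_nnsfun_approx => // t _; rewrite /= lee_fin.
have mXp A : measurable A -> measurable (X @^-1` A).
  by move=> mA; rewrite -[_ @^-1` _]setTI; exact: mX.
transitivity (limn (fun n => \int[m]_x (h n x)%:E)%E).
  rewrite -monotone_convergence//.
  - by apply: eq_integral => x _; apply/esym/cvg_lim => //; exact: hf.
  - by move=> n; exact/measurable_EFinP/measurable_funP.
  - by move=> n x _; rewrite lee_fin.
  - by move=> x _ a b ab; rewrite lee_fin; exact/lefP/nd_nnsfun_approx.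
have mhX n : measurable_fun setT (fun x => h n (X x)).
  exact: measurableT_comp.
transitivity (limn (fun n => \int[mu]_x (h n (X x) * g x)%:E)%E); last first.
  rewrite -monotone_convergence//.
  - apply: eq_integral => x _; apply/cvg_lim => //.
    rewrite EFinM; under eq_fun do rewrite EFinM.
    by apply: cvgeZr => //; exact: (hf (X x)).
  - by move=> n; apply/measurable_EFinP; exact: measurable_funM.
  - by move=> n x _; rewrite lee_fin mulr_ge0.
  - move=> x _ a b ab; rewrite lee_fin ler_wpM2r//.
    by have /lefP := nd_nnsfun_approx measurableT mfE ab; exact.
congr (limn _); apply/funext => n.
transitivity (\int[m]_x (\sum_(y \in range (h n)) (y * \1_(h n @^-1` [set y]) x)%:E))%E.
  by apply: eq_integral => t _; rewrite /= fimfunE -fsumEFin.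
rewrite ge0_integral_fsum//; last 2 first.
- by move=> r; apply/measurable_EFinP; exact: measurable_funM.
- by move=> r x _; exact: nnfun_muleindic_ge0.
transitivity (\int[mu]_x (\sum_(y \in range (h n))
    (y * \1_(h n @^-1` [set y]) (X x))%:E * (g x)%:E))%E; last first.
  apply: eq_integral => t _.
  rewrite -ge0_mule_fsuml; last by move=> y; exact: nnfun_muleindic_ge0.
  by rewrite fsumEFin// -(fimfunE _ (X t)) EFinM.
have mind (r : R) : measurable_fun setT (fun x => \1_(h n @^-1` [set r]) (X x) : R).
  by apply: measurableT_comp => //; exact: measurable_indic.
rewrite ge0_integral_fsum//; last 2 first.
- move=> r; apply: emeasurable_funM => //; last exact/measurable_EFinP.
  by apply/measurable_EFinP; exact: measurable_funM.
- by move=> r x _; rewrite mule_ge0 ?lee_fin// -lee_fin; exact: nnfun_muleindic_ge0.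
apply: eq_fsbigr => r rhn.
under eq_integral do rewrite EFinM.
rewrite integralZl_indic_nnsfun// integral_indic//= setIT mE//.
have r0 : 0 <= r by move: rhn; rewrite inE => -[x _ <-].
under [RHS]eq_integral do rewrite EFinM -muleA.
rewrite ge0_integralZl//; last 2 first.
- by apply: emeasurable_funM; exact/measurable_EFinP.
- by move=> x _; rewrite mule_ge0 ?lee_fin.
congr (_ * _)%E.
rewrite [LHS]integral_mkcond; apply: eq_integral => x _.
rewrite patchE indicE/= ; case: ifPn => xr.
  by rewrite mem_set ?mul1e//; rewrite inE in xr.
by rewrite memNset ?mul0e//; rewrite notin_setE in xr.
Qed.

End IntegralTransfer.

Section IndependentEvent.
Context d d' (T : measurableType d) (T' : measurableType d') (R : realType).
Variables (P : {measure set T -> \bar R}) (nu : {measure set T' -> \bar R}).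
Variables (X : T -> T') (E : set T) (c : {nonneg R}).
Hypotheses (mX : measurable_fun setT X) (mE : measurable E).
Hypothesis indep : forall A, measurable A ->
  P (E `&` X @^-1` A) = (c%:num%:E * nu A)%E.

(** With [c = P E] and [nu] the law of [X], the hypothesis is independence of [E] and [X]. *)
Lemma ge0_integral_indep_event (f : T' -> R) : measurable_fun setT f ->
  (forall y, 0 <= f y) ->
  (\int[P]_(x in E) (f (X x))%:E = c%:num%:E * \int[nu]_y (f y)%:E)%E.
Proof.
move=> mf f0.
rewrite -ge0_integral_mscale//; last 2 first.
- exact/measurable_EFinP.
- by move=> y _; rewrite lee_fin.
rewrite (@ge0_integral_transfer _ _ _ _ _ P (mscale c nu) X \1_E)//.
- rewrite integral_mkcond; apply: eq_integral => x _.
  by rewrite patchE indicE; case: ifPn => _; rewrite ?mulr1 ?mulr0.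
- move=> A mA; rewrite integral_indic//; last first.
    by rewrite -[_ @^-1` _]setTI; exact: mX.
  exact: esym (indep mA).
Qed.
End IndependentEvent.

(** * Split vectors whose mixed coordinate law is Beta *)

Section SplitLaw.
Context (R : realType) (b : nat) d (Om : measurableType d) (P : probability Om R).
Variables (V : {RV P >-> b.-tuple R}) (I : Om -> 'I_b).
Hypotheses (b_gt0 : (0 < b)%N) (hI : uniform_indep_index V I).
Let Y w := tnth (V w) (I w).

Lemma measurable_split_coord (i : 'I_b) : measurable_fun setT (fun w => tnth (V w) i).
Proof. exact: measurableT_comp (measurable_tnth i) (measurable_funP V). Qed.

Let YE : Y = fun w => \sum_(i < b) tnth (V w) i * \1_(I @^-1` [set i]) w.
Proof.
apply/funext => w; rewrite (bigD1 (I w))//= big1 ?addr0 => [|i iw].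
  by rewrite indicE mem_set ?mulr1.
by rewrite indicE memNset ?mulr0//= => /esym/eqP; rewrite (negbTE iw).
Qed.

Lemma measurable_random_coord : measurable_fun setT Y.
Proof.
rewrite YE; apply: measurable_sum => i; apply: measurable_funM.
  exact: measurable_split_coord.
by apply: measurable_indic; exact: (ui_meas hI).
Qed.

(** Splits the space along the value of the uniform index, which is independent of the split
    vector. *)
Lemma integral_random_coord (f : R -> R) : measurable_fun setT f ->
  (forall t, 0 <= f t) ->
  (\int[P]_w (f (Y w))%:E =
   (b%:R^-1)%:E * \sum_(i < b) \int[P]_w (f (tnth (V w) i))%:E)%E.
Proof.
move=> mf f0.
have fYE w : (f (Y w))%:E =
    (\sum_(i < b) (f (tnth (V w) i) * \1_(I @^-1` [set i]) w)%:E)%E.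
  rewrite sumEFin; congr _%:E; rewrite (bigD1 (I w))//= big1 ?addr0 => [|i iw].
    by rewrite indicE mem_set ?mulr1.
  by rewrite indicE memNset ?mulr0//= => /esym/eqP; rewrite (negbTE iw).
under eq_integral do rewrite fYE.
rewrite ge0_integral_sum//; last 2 first.
- move=> i; apply/measurable_EFinP; apply: measurable_funM.
    exact: measurableT_comp (measurable_split_coord i).
  by apply: measurable_indic; exact: (ui_meas hI).
- by move=> i w _; rewrite lee_fin mulr_ge0.
rewrite ge0_sume_distrr; last first.
  by move=> i _; apply: integral_ge0 => w _; rewrite lee_fin.
apply: eq_bigr => i _.
have c0 : 0 <= b%:R^-1 :> R by rewrite invr_ge0.
transitivity (\int[P]_(w in I @^-1` [set i]) (f (tnth (V w) i))%:E)%E.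
  rewrite [RHS]integral_mkcond; apply: eq_integral => w _.
  by rewrite patchE indicE; case: ifPn => _; rewrite ?mulr1 ?mulr0.
have mft : measurable_fun setT (fun v : b.-tuple R => f (tnth v i)).
  exact: measurableT_comp (measurable_tnth i).
rewrite (@ge0_integral_indep_event _ _ _ _ _ P (distribution P V) V _ (NngNum c0) _ _ _
  (fun v => f (tnth v i)))//.
- by rewrite ge0_integral_distribution//; [exact/measurable_EFinP|move=> y; rewrite lee_fin].
- exact: (ui_meas hI).
- by move=> A mA; have := ui_indep hI i mA; rewrite (ui_unif hI).
Qed.

Variables (a : R) (q : nat).
Hypothesis hbeta : beta_distributed P Y a q.+1%:R.

Let a_gt0 : 0 < a. Proof. by case: hbeta. Qed.
Let B_gt0 : 0 < beta_int a q.
Proof. by rewrite divr_gt0 ?rising_gt0// ltr0n fact_gt0. Qed.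

Lemma beta_law_set (A : set R) : measurable A -> P (Y @^-1` A) =
  (\int[lebesgue_measure]_(t in A)
    (t `^ (a - 1) * (1 - t) ^+ q / beta_int a q * \1_(`]0%R, 1%R[%classic) t)%:E)%E.
Proof.
move=> mA; case: hbeta => _ _ ->//.
rewrite integral_mkcondr; apply: eq_integral => t _.
rewrite patchE indicE; case: ifPn => [|_]; last by rewrite mulr0.
by rewrite inE/= in_itv/= => t01; rewrite mulr1 beta_weight_nat// beta_constE.
Qed.

Lemma integral_beta_law (f : R -> R) : measurable_fun setT f ->
  (forall t, 0 <= f t) ->
  (\int[P]_w (f (Y w))%:E = \int[lebesgue_measure]_(t in `]0%R, 1%R[)
    (f t * (t `^ (a - 1) * (1 - t) ^+ q / beta_int a q))%:E)%E.
Proof.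
move=> mf f0.
have mfE : measurable_fun setT (EFin \o f) by exact/measurable_EFinP.
pose g (t : R) : R := `|t `^ (a - 1) * (1 - t) ^+ q / beta_int a q| * \1_(`]0%R, 1%R[%classic) t.
have gE t : g t = t `^ (a - 1) * (1 - t) ^+ q / beta_int a q * \1_(`]0%R, 1%R[%classic) t.
  rewrite /g indicE; case: (boolP (t \in _)) => [|_]; last by rewrite !mulr0.
  rewrite inE/= in_itv/= => t01; rewrite !mulr1 ger0_norm//.
  by rewrite divr_ge0 ?(ltW B_gt0)// mulr_ge0 ?powR_ge0//; case/andP: (onemX_itv01 q t01).
have mg : measurable_fun setT g.
  apply: measurable_funM; last exact: measurable_indic.
  apply: measurableT_comp => //; apply: measurable_funM => //.
  apply: measurable_funM; first exact: measurable_powR.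
  by apply: measurable_funX; exact: measurable_funB.
pose mYf := isMeasurableFun.Build _ _ _ _ Y measurable_random_coord.
pose Yf : {mfun Om >-> R} := HB.pack Y mYf.
have E1 : (\int[distribution P Yf]_y (f y)%:E = \int[P]_w (f (Y w))%:E)%E.
  by rewrite ge0_integral_distribution// => y; rewrite lee_fin.
rewrite -E1.
have := @ge0_integral_transfer _ _ _ _ R (@lebesgue_measure R) (distribution P Yf) id g.
move=> ->//.
- rewrite [RHS]integral_mkcond; apply: eq_integral => t _.
  by rewrite patchE gE indicE; case: ifPn => _; rewrite ?mulr1// !mulr0.
- by move=> t; rewrite /g mulr_ge0// indicE.
- by move=> A mA; rewrite [LHS](beta_law_set mA); apply: eq_integral => t _; rewrite gE.
Qed.

Lemma sum_integral_coord (f : R -> R) : measurable_fun setT f ->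
  (forall t, 0 <= f t) ->
  (\sum_(i < b) \int[P]_w (f (tnth (V w) i))%:E =
   b%:R%:E * \int[lebesgue_measure]_(t in `]0%R, 1%R[)
    (f t * (t `^ (a - 1) * (1 - t) ^+ q / beta_int a q))%:E)%E.
Proof.
move=> mf f0; rewrite -integral_beta_law// integral_random_coord// muleA -EFinM.
by rewrite divff ?mul1e// pnatr_eq0 -lt0n.
Qed.

Lemma sum_integral_coord_real (f h : R -> R) : measurable_fun setT f ->
  (forall t, 0 <= f t) ->
  lebesgue_measure.-integrable `]0%R, 1%R[ (EFin \o h) ->
  (forall t, 0 < t < 1 -> f t * (t `^ (a - 1) * (1 - t) ^+ q) = h t) ->
  (\sum_(i < b) \int[P]_w (f (tnth (V w) i))%:E =
   (b%:R / beta_int a q * \int[lebesgue_measure]_(t in `]0%R, 1%R[) h t)%:E)%E.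
Proof.
move=> mf f0 hi fh; rewrite sum_integral_coord// -mulrA EFinM; congr (_ * _)%E.
have hfin := @integrable_fin_num _ _ _ (@lebesgue_measure R) _ (measurable_itv _) _ hi.
rewrite EFinM /Rintegral fineK//.
rewrite -integralZl//; apply: eq_integral => t; rewrite inE/= in_itv/= => t01.
by rewrite /= -EFinM -fh// mulrA mulrC.
Qed.

Lemma random_coord_itv01 : P (Y @^-1` (~` `]0%R, 1%R[)) = 0%E.
Proof.
rewrite beta_law_set; last by apply: measurableC; exact: measurable_itv.
by apply: integral0_eq => t /= t01; rewrite indicE memNset ?mulr0.
Qed.

End SplitLaw.

Section BetaSplit.
Context (R : realType) (b : nat) d (Om : measurableType d) (P : probability Om R).
Variables (V : {RV P >-> b.-tuple R}) (I : Om -> 'I_b).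
Hypotheses (b_gt0 : (0 < b)%N) (hI : uniform_indep_index V I).
Let Y w := tnth (V w) (I w).
Variables (a beta : R) (q : nat).
Hypotheses (beta_gt0 : 0 < beta)
  (hY : beta_distributed P Y a q.+1%:R)
  (hbeta : ('E_P[fun w => (\sum_(i < b) tnth (V w) i `^ beta)%R] = 1)%E).
Let al := a + beta.

Let a_gt0 : 0 < a. Proof. by case: hY. Qed.
Let al_gt0 : 0 < al. Proof. exact: addr_gt0. Qed.
Let B_gt0 : 0 < beta_int a q.
Proof. by rewrite divr_gt0 ?rising_gt0// ltr0n fact_gt0. Qed.
Let fact_neq0 n : n`!%:R != 0 :> R.
Proof. by rewrite pnatr_eq0 -lt0n fact_gt0. Qed.

(** [E sum_i V_i ^ beta = 1], evaluated under the Beta law. *)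
Lemma beta_int_ratio : b%:R / beta_int a q * beta_int al q = 1.
Proof.
move: hbeta; rewrite unlock.
under eq_integral do rewrite -sumEFin.
rewrite ge0_integral_sum//; last 2 first.
- move=> i; apply/measurable_EFinP.
  apply: (@measurableT_comp _ _ _ _ _ _ (fun t : R => t `^ beta)).
    exact: measurable_powR.
  exact: measurable_split_coord.
- by move=> i w _; rewrite lee_fin powR_ge0.
rewrite (@sum_integral_coord_real _ _ _ _ P V I b_gt0 hI a q hY (fun t => t `^ beta)
  (fun t => t `^ (al - 1) * (1 - t) ^+ q)).
- by rewrite Rintegral_beta// => -[].
- exact: measurable_powR.
- by move=> t; exact: powR_ge0.
- by apply: integrable_onemX; exact: (integrable_Rintegral_powR01 al_gt0).1.
- move=> t /andP[t0 _]; rewrite mulrA -powRD_gt0//; congr (_ `^ _ * _).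
  by rewrite /al; ring.
Qed.

(** The equation for [beta] in closed form. *)
Lemma rising_malthusian : b%:R * rising a q.+1 = rising al q.+1.
Proof.
have := beta_int_ratio; rewrite /beta_int => h.
have r1 := rising_gt0 q.+1 a_gt0; have r2 := rising_gt0 q.+1 al_gt0.
move: (rising a _) (rising al _) h r1 r2 => A B h A0 B0.
transitivity (b%:R / (q`!%:R / A) * (q`!%:R / B) * B); last by rewrite h mul1r.
by field; rewrite fact_neq0 !gt_eqF.
Qed.

Lemma split_mu_harm : split_mu b P Y beta = (rising_harmonic al q.+1)%:E.
Proof.
(* The positive part, as the random coordinate is in ]0, 1[ only almost surely. *)
pose f (t : R) : R := t `^ beta * Num.max 0 (- ln t).
have mf : measurable_fun setT f.
  apply: measurable_funM; first exact: measurable_powR.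
  by apply: measurable_maxr => //; apply: measurableT_comp => //; exact: measurable_ln.
have f0 t : 0 <= f t by rewrite mulr_ge0 ?powR_ge0// le_max lexx.
have mY := measurable_random_coord hI.
rewrite /split_mu unlock.
transitivity (\int[P]_w (b%:R%:E * (f (Y w))%:E))%E.
  apply: ae_eq_integral => //.
  - apply/measurable_EFinP; apply: measurable_funM.
      by apply: measurable_funM => //; exact: measurableT_comp (@measurable_powR R beta) mY.
    exact: measurableT_comp (@measurable_ln R) mY.
  - apply/measurable_funeM/measurable_EFinP; exact: measurableT_comp mf mY.
  exists (Y @^-1` (~` `]0%R, 1%R[)); split.
  - by rewrite -[_ @^-1` _]setTI; apply: mY => //; apply: measurableC; exact: measurable_itv.
  - exact: (random_coord_itv01 hY).
  - move=> w /= h t01; apply: h => _; move: t01; rewrite in_itv/= => /andP[t0 t1].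
    rewrite -EFinM /f; congr _%:E.
    by rewrite max_r ?oppr_ge0 ?ln_le0 ?(ltW t1)// mulNr mulNr mulrN mulrN mulrA.
rewrite ge0_integralZl//; last first.
- by move=> w _; rewrite lee_fin.
- by apply/measurable_EFinP; exact: measurableT_comp mf mY.
rewrite (integral_random_coord hI)// muleA -EFinM divff ?pnatr_eq0 -?lt0n// mul1e.
rewrite (@sum_integral_coord_real _ _ _ _ P V I b_gt0 hI a q hY f
  (fun t => t `^ (al - 1) * (- ln t) * (1 - t) ^+ q)) //.
- by rewrite Rintegral_beta_ln// mulrA beta_int_ratio mul1r.
- by apply: integrable_onemX; exact: (integrable_Rintegral_powR_Nln01 al_gt0).1.
- move=> t /andP[t0 t1].
  rewrite /f max_r ?oppr_ge0 ?ln_le0 ?(ltW t1)//.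
  rewrite (_ : al - 1 = (a - 1) + beta); last by rewrite /al; ring.
  by rewrite (powRD_gt0 (a - 1) beta t0); ring.
Qed.

Lemma rising_addn (x : R) m n : rising x (m + n) = rising x m * rising (x + m%:R) n.
Proof.
elim: n => [|n IH]; first by rewrite addn0 rising0 mulr1.
by rewrite addnS !risingSr IH natrD mulrA addrA.
Qed.

Lemma beta_binomial_kernel s1 m j (f : R -> R) : measurable_fun setT f ->
  (forall t, 0 <= f t) -> (forall t, 0 < t < 1 -> f t = bin_pmf s1 m j t) ->
  (\sum_(i < b) \int[P]_w (f (tnth (V w) i))%:E =
   (if (s1 <= j <= s1 + m)%N then euler_kernel a beta q (m + q.+1) (j - s1) else 0)%:E)%E.
Proof.
move=> mf f0 fE.
rewrite (@sum_integral_coord_real _ _ _ _ P V I b_gt0 hI a q hY f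
  (fun t => (if (s1 <= j <= s1 + m)%N then 'C(m, j - s1)%:R else 0) *
    (t `^ (a + (j - s1)%:R - 1) * (1 - t) ^+ (q + (m - (j - s1)))))) //; last 2 first.
- apply: (@integrableZl_EFin _ _ _ (@lebesgue_measure R)) => //.
  by apply: integrable_onemX; apply: (integrable_Rintegral_powR01 _).1; exact: addr_natr_gt0.
- move=> t t01; rewrite fE// /bin_pmf; case: ifP => _; last by rewrite !mul0r.
  case/andP: t01 => t0 t1.
  rewrite (_ : a + _ - 1 = (a - 1) + (j - s1)%:R); last by ring.
  by rewrite (powRD_gt0 (a - 1) (j - s1)%:R t0) powR_mulrn ?(ltW t0)// exprD; ring.
rewrite RintegralZl//; last first.
  by apply: integrable_onemX; apply: (integrable_Rintegral_powR01 _).1; exact: addr_natr_gt0.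
rewrite Rintegral_beta; last exact: addr_natr_gt0.
case: ifP => [/andP[sj jm]|_]; last by rewrite mul0r mulr0.
have {jm}: (j - s1 <= m)%N by rewrite leq_subLR.
move: (j - s1)%N => {sj} i im; congr _%:E.
rewrite /euler_kernel addnS/= -addnS addnK /beta_int -/al -rising_malthusian.
have -> : (m + q - i = q + (m - i))%N by rewrite [RHS]addnC addnBAC.
have -> : (m + q.+1 = i + (q + (m - i)).+1)%N by rewrite -addSn addnCA addnC subnKC// addnC.
rewrite rising_addn.
have hC : 'C(q + (m - i), q)%:R * (q`!%:R * (m - i)`!%:R) = (q + (m - i))`!%:R :> R.
  rewrite -!natrM; congr _%:R; rewrite -(bin_fact (leq_addr (m - i) q)).
  by rewrite addKn.
rewrite -hC -(bin_fact im) !natrM.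
have r1 := rising_gt0 i a_gt0; have r2 := rising_gt0 q.+1 a_gt0.
have r3 := rising_gt0 (q + (m - i)).+1 (addr_natr_gt0 i a_gt0).
by field; rewrite !fact_neq0 !gt_eqF.
Qed.

Lemma rising_lt (x y : R) : 0 < x -> x < y -> rising x q.+1 < rising y q.+1.
Proof.
move=> x0 xy; have y0 := lt_trans x0 xy; elim: q => [|n IH].
  by rewrite !risingSr !rising0 !mul1r !addr0.
rewrite risingSr (risingSr y); apply: ltr_pM => //; try exact: ltW (rising_gt0 _ _).
  exact: ltW (addr_natr_gt0 _ _).
by rewrite ltrD2r.
Qed.

(** [rising] is strictly increasing and [beta <= 1], so [b rising a = rising (a + beta)] is at
    most [rising (a + 1) = rising a * (a + q.+1) / a]. *)
Lemma malthus_bound : beta <= 1 ->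
  b%:R * a <= a + q.+1%:R /\ (b%:R * a = a + q.+1%:R <-> beta = 1).
Proof.
move=> beta1.
have E1 : a * rising (a + 1) q.+1 = (a + q.+1%:R) * rising a q.+1.
  by rewrite -risingSl risingSr mulrC.
have r1 := rising_gt0 q.+1 a_gt0.
have M := rising_malthusian.
have [lt1|ge1|e1] := ltgtP beta 1.
- have : rising al q.+1 < rising (a + 1) q.+1 by apply: rising_lt => //; rewrite ltrD2l.
  rewrite -M -(ltr_pM2l a_gt0) E1 mulrA ltr_pM2r// mulrC => h.
  split; first exact: ltW.
  split=> e; first by rewrite e ltxx in h.
  by rewrite e ltxx in lt1.
- by move: beta1; rewrite leNgt ge1.
- move: M; rewrite /al e1 => M.
  have e : b%:R * a = a + q.+1%:R.
    apply: (mulIf (lt0r_neq0 r1)).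
    by rewrite -E1 -M; ring.
  by rewrite e; split.
Qed.
End BetaSplit.

(** * One splitting step of the random tree *)

Section FiniteDisjointUnion.
Context d (T : measurableType d) (R : realType) (P : {measure set T -> \bar R}).

Lemma measure_disjoint_sum (I : finType) (Q : pred I) (A : I -> set T) (B : set T) :
  (forall i, measurable (A i)) ->
  (forall i j w, A i w -> A j w -> i = j) ->
  (forall w, B w <-> exists2 i, Q i & A i w) ->
  P B = (\sum_(i | Q i) P (A i))%E.
Proof.
move=> mA dis BE.
have -> : B = \bigcup_(i in [set` enum Q]) A i.
  apply/seteqP; split=> w.
    by move=> /BE[i Qi Aiw]; exists i => //=; rewrite mem_enum.
  by move=> [i /=]; rewrite mem_enum => Qi Aiw; apply/BE; exists i.
rewrite measure_fin_bigcup//.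
- by rewrite -fsbig_seq ?enum_uniq//= big_enum.
- by move=> i j _ _ [w [Ai Aj]]; exact: dis Ai Aj.
Qed.
End FiniteDisjointUnion.

Section Simplex.
Variables (R : realType) (b s1 : nat).
Implicit Types v : b.-tuple R.

Definition simplex : set (b.-tuple R) :=
  [set v | (forall i, 0 <= tnth v i) /\ \sum_(i < b) tnth v i <= 1].

Lemma measurable_simplex : measurable simplex.
Proof.
have mt i : measurable_fun setT (fun v : b.-tuple R => tnth v i).
  exact: measurable_tnth.
have -> : simplex = \bigcap_(i in [set` enum 'I_b]) [set v | 0 <= tnth v i] `&`
    [set v | \sum_(i < b) tnth v i <= 1].
  apply/seteqP; split=> v /=; first by case=> v0 v1; split=> // i _; exact: v0.
  by case=> v0 v1; split=> // i; apply: v0; rewrite /= mem_enum.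
apply: measurableI.
  apply: fin_bigcap_measurable => // i _.
  have -> : [set v : b.-tuple R | 0 <= tnth v i] = (fun v => tnth v i) @^-1` `[0, +oo[.
    by apply/seteqP; split=> v /=; rewrite in_itv/= andbT.
  by rewrite -[_ @^-1` _]setTI; apply: mt => //; exact: measurable_itv.
have ms : measurable_fun setT (fun v : b.-tuple R => \sum_(i < b) tnth v i).
  exact: measurable_sum.
have -> : [set v : b.-tuple R | \sum_(i < b) tnth v i <= 1] =
    (fun v => \sum_(i < b) tnth v i) @^-1` `]-oo, 1].
  by apply/seteqP; split=> v /=; rewrite in_itv/=.
by rewrite -[_ @^-1` _]setTI; apply: ms => //; exact: measurable_itv.
Qed.

Lemma measurable_children_pmf m (c : 'I_b -> nat) :
  measurable_fun setT (fun v : b.-tuple R => children_pmf s1 m v c).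
Proof.
have mt i : measurable_fun setT (fun v : b.-tuple R => tnth v i).
  exact: measurable_tnth.
rewrite /children_pmf; under eq_fun do rewrite big_mkcond/=.
apply: measurable_sum => x.
case: [forall i : 'I_b, (x (lift ord_max i) + s1 == c i)%N] => //.
rewrite /mult_pmf; case: (\sum_(j < b.+1) x j == m)%N => //.
apply: measurable_funM => //.
apply: measurable_prod => i _; apply: measurable_funX.
case: (unliftP ord_max i) => [j|] ->.
  under eq_fun do rewrite tnth_full_lift.
  exact: mt.
under eq_fun do rewrite tnth_full_max.
by apply: measurable_funB => //; exact: measurable_sum.
Qed.

(** Outside the simplex the multinomial weights can be negative.  The truncation makes all the
    integrands below nonnegative everywhere, at the cost of a null event. *)
Definition proper_pmf m c v := children_pmf s1 m v c * \1_simplex v.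

Lemma proper_pmf_ge0 m c v : 0 <= proper_pmf m c v.
Proof.
rewrite /proper_pmf indicE; case: (boolP (v \in _)); last by rewrite mulr0.
by rewrite inE mulr1 => -[v0 v1]; exact: children_pmf_ge0.
Qed.

Lemma measurable_proper_pmf m c : measurable_fun setT (proper_pmf m c).
Proof.
apply: measurable_funM; first exact: measurable_children_pmf.
by apply: measurable_indic; exact: measurable_simplex.
Qed.

Lemma measurable_bin_pmf m j : measurable_fun setT (@bin_pmf R s1 m j).
Proof.
rewrite /bin_pmf; case: (s1 <= j <= s1 + m)%N => //; apply: measurable_funM.
  by apply: measurable_funM => //; exact: measurable_funX.
by apply: measurable_funX; exact: measurable_funB.
Qed.

Definition proper_bin m j i v := bin_pmf s1 m j (tnth v i) * \1_simplex v.

Lemma sum_proper_pmf m v :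
  \sum_(y : {ffun 'I_b -> 'I_m.+1}) proper_pmf m (shifted s1 y) v = \1_simplex v.
Proof. by rewrite -mulr_suml sum_children_pmf1 mul1r. Qed.

Lemma sum_proper_pmf_marginal m v i j :
  \sum_(y : {ffun 'I_b -> 'I_m.+1} | shifted s1 y i == j) proper_pmf m (shifted s1 y) v =
  proper_bin m j i v.
Proof. by rewrite -mulr_suml sum_children_pmf_marginal. Qed.

Lemma proper_bin_ge0 m j i v : 0 <= proper_bin m j i v.
Proof.
by rewrite -sum_proper_pmf_marginal; apply: sumr_ge0 => y _; exact: proper_pmf_ge0.
Qed.

Lemma measurable_proper_bin m j i : measurable_fun setT (proper_bin m j i).
Proof.
apply: measurable_funM; last by apply: measurable_indic; exact: measurable_simplex.
exact: measurableT_comp (measurable_bin_pmf m j) (measurable_tnth i).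
Qed.
End Simplex.

Section TreeLaw.
Context (R : realType) (b s s0 s1 : nat) (nu : probability (b.-tuple R) R) (n : nat).
Variable T : split_tree s s0 s1 nu n.
Hypothesis nu_simplex : nu (~` (@simplex R b)) = 0%E.

Let P := st_prob T.
Let Vv (u : seq 'I_b) : st_space T -> b.-tuple R := st_vec T u.
Let N := @st_count _ _ _ _ _ _ _ T.
Let sp l := (l - s0 - b * s1)%N.

Lemma measurable_vec_event u A : measurable A -> measurable (Vv u @^-1` A).
Proof.
move=> mA; rewrite -[_ @^-1` _]setTI; exact: (measurable_funP (st_vec T u)).
Qed.

Lemma past_measurable v G : past Vv N v G -> measurable G.
Proof.
apply: smallest_sub; first exact: sigma_algebra_measurable.
move=> B [[u [A [mA ->]]]|[w [k [_ ->]]]]; first exact: measurable_vec_event.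
exact: st_count_meas.
Qed.

Lemma past_vec v u A : measurable A -> past Vv N v (Vv u @^-1` A).
Proof. by move=> mA; apply: sub_sigma_algebra; left; exists u, A. Qed.

Lemma past_count v k : past Vv N v (N v @^-1` [set k]).
Proof.
apply: sub_sigma_algebra; right; exists v, k; split=> //.
by rewrite /strict_desc eqxx andbF.
Qed.

Lemma pastI v G H : past Vv N v G -> past Vv N v H -> past Vv N v (G `&` H).
Proof. exact: (@measurableI _ (g_sigma_algebraType _)). Qed.

Definition vec_event (us : seq (seq 'I_b)) (A : seq 'I_b -> set (b.-tuple R)) :=
  \bigcap_(u in [set` us]) (Vv u @^-1` A u).

Lemma past_vec_event v us A : (forall u, measurable (A u)) -> past Vv N v (vec_event us A).
Proof.
move=> mA; apply: (@fin_bigcap_measurable _ (g_sigma_algebraType _)) => // u _.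
exact: past_vec.
Qed.

Section OneStep.
Variables (w : seq 'I_b) (l : nat) (E : set (st_space T)).
Hypotheses (sl : (s < l)%N) (pastE : past Vv N w E) (El : E `<=` N w @^-1` [set l]).

Let mE : measurable E. Proof. exact: past_measurable pastE. Qed.

Let children c := [set x : st_space T | forall i, N (rcons w i) x = c i].

Let measurable_children c : measurable (children c).
Proof.
have -> : children c = \bigcap_(i in [set` enum 'I_b]) (N (rcons w i) @^-1` [set c i]).
  apply/seteqP; split=> x /=; first by move=> h i _; exact: h.
  by move=> h i; apply: h; rewrite /= mem_enum.
by apply: fin_bigcap_measurable => // i _; exact: st_count_meas.
Qed.

Let Nl x : E x -> N w x = l. Proof. by move/El. Qed.

(** The defining property of the tree, with the parameter [n_w = l] made constant and the
    split vector restricted to the simplex. *)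
Lemma prob_children c : P (E `&` children c) =
  (\int[P]_(x in E) (proper_pmf s1 (sp l) c (Vv w x))%:E)%E.
Proof.
have := @st_split _ _ _ _ _ _ _ T w c E pastE.
rewrite (_ : E `&` [set x | (s < N w x)%N] = E); last first.
  by apply/seteqP; split=> x; [case|move=> Ex; split=> //=; rewrite (Nl Ex)].
rewrite (_ : E `&` [set x | _ /\ _] = E `&` children c); last first.
  apply/seteqP; split=> x [Ex /=]; first by case=> _ h; split.
  by move=> h; split=> //=; split=> //; rewrite -/(N w x) (Nl Ex).
move=> ->; apply: ae_eq_integral => //.
- apply: (@eq_measurable_fun _ _ _ _ _ (fun x => (children_pmf s1 (sp l) (Vv w x) c)%:E)).
    by move=> x; rewrite inE => /El <-.
  apply/measurable_EFinP/measurable_funTS.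
  exact: measurableT_comp (measurable_children_pmf _ _ _) (measurable_funP (st_vec T w)).
- apply/measurable_EFinP/measurable_funTS.
  exact: measurableT_comp (measurable_proper_pmf _ _ _) (measurable_funP (st_vec T w)).
exists (Vv w @^-1` (~` (@simplex R b))); split.
- by apply: measurable_vec_event; apply: measurableC; exact: measurable_simplex.
- have := @st_vec_law _ _ _ _ _ _ _ T w _ (measurableC (@measurable_simplex R b)).
  by rewrite nu_simplex.
- move=> x /= h vs; apply: h => /El /= h.
  by rewrite /proper_pmf indicE mem_set ?mulr1//; rewrite -h.
Qed.

Variable c : {nonneg R}.
Hypothesis indep : forall A, measurable A -> P (E `&` Vv w @^-1` A) = (c%:num%:E * nu A)%E.

Let PE : P E = c%:num%:E.
Proof.
by rewrite -[E]setIT -(preimage_setT (Vv w)) indep// probability_setT mule1.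
Qed.

Let integralE (f : b.-tuple R -> R) : measurable_fun setT f -> (forall v, 0 <= f v) ->
  (\int[P]_(x in E) (f (Vv w x))%:E = c%:num%:E * \int[nu]_v (f v)%:E)%E.
Proof.
move=> mf f0; apply: ge0_integral_indep_event => //.
Qed.

(** The multinomial weights over all outcomes sum to [1], so almost surely the children have
    one of these outcomes; then the marginal of the multinomial law applies. *)
Lemma prob_child i j : P (E `&` N (rcons w i) @^-1` [set j]) =
  (c%:num%:E * \int[nu]_v (proper_bin s1 (sp l) j i v)%:E)%E.
Proof.
pose m := sp l.
pose A (y : {ffun 'I_b -> 'I_m.+1}) := E `&` children (shifted s1 y).
have mA y : measurable (A y) by exact: measurableI.
have dis y z x : A y x -> A z x -> y = z.
  move=> [_ h1] [_ h2]; apply/ffunP => r; apply/val_inj/eqP.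
  by rewrite -(eqn_add2r s1) -[(y r + s1)%N]h1 -[(z r + s1)%N]h2.
have mf y := measurable_proper_pmf (R := R) s1 m (shifted s1 y).
have f0 y v := proper_pmf_ge0 s1 m (shifted s1 y) v.
have PA y : P (A y) = (c%:num%:E * \int[nu]_v (proper_pmf s1 m (shifted s1 y) v)%:E)%E.
  by rewrite prob_children integralE.
have sumPA (Q : pred {ffun 'I_b -> 'I_m.+1}) : (\sum_(y | Q y) P (A y) =
    c%:num%:E * \int[nu]_v (\sum_(y | Q y) proper_pmf s1 m (shifted s1 y) v)%:E)%E.
  under [in RHS]eq_integral do rewrite -sumEFin.
  under eq_bigr do rewrite PA.
  rewrite -ge0_sume_distrr; last first.
    by move=> y _; apply: integral_ge0 => v _; rewrite lee_fin; exact: f0.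
  under [in RHS]eq_integral do rewrite big_mkcond/=.
  rewrite ge0_integral_sum//.
  - rewrite big_mkcond/=; congr (_ * _)%E; apply: eq_bigr => y _.
    by case: (Q y) => //; rewrite integral0.
  - by move=> y; case: (Q y) => //; apply/measurable_EFinP; exact: mf.
  - by move=> y v _; case: (Q y) => //; rewrite lee_fin; exact: f0.
(* [F] has full measure in [E]. *)
pose F := \bigcup_(y in [set: {ffun 'I_b -> 'I_m.+1}]) A y.
have mF : measurable F by apply: fin_bigcup_measurable => //; exact: finite_finset.
have PF : P F = P E.
  rewrite (@measure_disjoint_sum _ _ _ _ _ predT A F mA dis); last first.
    by move=> x; split=> [[y _ Ax]|[y _ Ax]]; exists y.
  rewrite sumPA PE; under eq_integral do rewrite sum_proper_pmf.
  rewrite integral_indic//; last exact: measurable_simplex.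
  have := probability_setC nu (measurableC (@measurable_simplex R b)).
  by rewrite setCK nu_simplex sube0 setIT => nu1; rewrite [X in (_ * X)%E]nu1 mule1.
have FE : F `<=` E by move=> x [y _ []].
have PEF : P (E `\` F) = 0%E.
  rewrite measureD//; last by rewrite -ge0_fin_numE// fin_num_measure.
  by rewrite setIidr// [X in (_ - X)%E]PF subee// fin_num_measure.
have mj : measurable (N (rcons w i) @^-1` [set j]) by exact: st_count_meas.
transitivity (P (F `&` N (rcons w i) @^-1` [set j])).
  apply/eqP; rewrite eq_le; apply/andP; split; last first.
    by apply: le_measure; rewrite ?inE; [exact: measurableI|exact: measurableI|exact: setSI].
  apply: (@le_trans _ _ (P ((F `&` N (rcons w i) @^-1` [set j]) `|` (E `\` F)))).
    apply: le_measure; rewrite ?inE.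
    - exact: measurableI.
    - by apply: measurableU; [exact: measurableI|exact: measurableD].
    - move=> x [Ex jx]; have [Fx|Fx] := pselect (F x); first by left.
      by right.
  have mFj : measurable (F `&` N (rcons w i) @^-1` [set j]) by exact: measurableI.
  have mEF : measurable (E `\` F) by exact: measurableD.
  apply: le_trans (measureU2 P mFj mEF) _.
  by rewrite [X in (_ + X)%E]PEF adde0.
rewrite (@measure_disjoint_sum _ _ _ _ _ (fun y => shifted s1 y i == j) A _ mA dis).
  rewrite sumPA; congr (_ * _)%E; apply: eq_integral => v _.
  by rewrite sum_proper_pmf_marginal.
move=> x; split=> [[[y _ Ayx] jx]|[y /eqP yj Ayx]].
  by exists y => //; apply/eqP; rewrite -jx; case: Ayx => _ /(_ i).
by split; [exists y|rewrite /= -yj; case: Ayx => _ /(_ i)].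
Qed.
End OneStep.

(** The probability that the [i]-th child of a node with [l] balls has [j] balls. *)
Definition child_mean (l j : nat) (i : 'I_b) : \bar R :=
  if (s < l)%N then (\int[nu]_v (proper_bin s1 (sp l) j i v)%:E)%E else ((j == 0%N)%:R)%:E.

Lemma child_mean_ge0 l j i : (0 <= child_mean l j i)%E.
Proof.
rewrite /child_mean; case: ifP => _; last by rewrite lee_fin.
by apply: integral_ge0 => v _; rewrite lee_fin proper_bin_ge0.
Qed.

Lemma strict_desc_rcons (w : seq 'I_b) i : strict_desc w (rcons w i).
Proof.
rewrite /strict_desc -cats1 prefix_prefix/=; apply/eqP => /(congr1 size).
by rewrite size_cat/=; lia.
Qed.

Lemma strict_desc_trans (u v w : seq 'I_b) : strict_desc u v -> strict_desc v w -> strict_desc u w.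
Proof.
move=> /andP[/prefixP[x ->] ux] /andP[/prefixP[y ->] vy]; rewrite /strict_desc.
rewrite -catA prefix_prefix/=; apply: contraNneq ux => /(congr1 size).
rewrite !size_cat => h; have /size0nil -> : size x = 0%N by lia.
by rewrite cats0.
Qed.

Definition vec_indep_count v := forall us A j, uniq us ->
  (forall u, measurable (A u)) -> (forall u, u \in us -> ~~ strict_desc u v) ->
  P (N v @^-1` [set j] `&` vec_event us A) =
  (P (N v @^-1` [set j]) * \prod_(u <- us) nu (A u))%E.

(** The hypothesis at [w], used for the family enlarged by [w] itself, says that the event
    before the split is independent of the split vector of [w]; then [prob_child] applies. *)
Lemma count_step_event w l us A i j : vec_indep_count w -> uniq us ->
  (forall u, measurable (A u)) -> (forall u, u \in us -> ~~ strict_desc u (rcons w i)) ->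
  P (N w @^-1` [set l] `&` (N (rcons w i) @^-1` [set j] `&` vec_event us A)) =
  (P (N w @^-1` [set l]) * child_mean l j i * \prod_(u <- us) nu (A u))%E.
Proof.
move=> Iw uus mA hus.
have hus' u : u \in us -> ~~ strict_desc u w.
  by move=> /hus; apply: contra => /strict_desc_trans; apply; exact: strict_desc_rcons.
have wus : w \notin us by apply/negP => /hus; rewrite strict_desc_rcons.
rewrite [_ `&` vec_event us A]setIC setIA /child_mean.
have [sl|ls] := ltnP s l; last first.
  have N0 x : (N w @^-1` [set l]) x -> N (rcons w i) x = 0%N.
    move=> /= Nl; apply: (@st_stop _ _ _ _ _ _ _ T w) (strict_desc_rcons w i).
    by rewrite -/(N w x) Nl.
  have [->|j0] := eqVneq j 0%N.
    rewrite mule1 -Iw//; congr (P _); apply/seteqP; split=> x; first by case.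
    by move=> [Nx vx]; split=> //=; exact: N0.
  rewrite mule0 mul0e (_ : _ `&` _ = set0) ?measure0//.
  by apply/seteqP; split=> x// [[/N0/= Nx _]/=]; rewrite Nx => /esym/eqP; rewrite (negbTE j0).
set E := _ `&` vec_event us A.
have pastE : past Vv N w E by apply: pastI; [exact: past_count|exact: past_vec_event].
have PE : P E = (P (N w @^-1` [set l]) * \prod_(u <- us) nu (A u))%E by exact: Iw.
have finE : P E \is a fin_num by apply: fin_num_measure; exact: past_measurable pastE.
have c0 : 0 <= fine (P E) by exact: fine_ge0.
rewrite (@prob_child w l E sl pastE _ (NngNum c0)).
- by rewrite /= fineK// PE muleAC.
- by move=> x [].
- move=> B mB; rewrite /= fineK// PE.
  (* Adding [w] to the family turns the event into one of the same shape. *)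
  pose A' u := if u == w then B else A u.
  have -> : E `&` Vv w @^-1` B = N w @^-1` [set l] `&` vec_event (w :: us) A'.
    rewrite /E -setIA; congr (_ `&` _); apply/seteqP; split=> x.
      move=> [h Bx] u /=; rewrite inE => /predU1P[->|uus']; first by rewrite /A' eqxx.
      by rewrite /A'; case: eqP => [->//|_]; exact: h.
    move=> h; split=> [u /= uus'|].
      have := h u; rewrite /= inE uus' orbT /A' => /(_ isT).
      by case: eqP wus => // <-; rewrite uus'.
    by have := h w; rewrite /= inE eqxx /A' eqxx; exact.
  rewrite Iw/= ?wus//.
  + rewrite big_cons {1}/A' eqxx -muleA; congr (_ * _)%E.
    rewrite muleC; congr (_ * _)%E.
    rewrite big_seq [RHS]big_seq; apply: eq_bigr => u uus'.
    by rewrite /A' (_ : (u == w) = false)//; apply: contraNF wus => /eqP <-.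
  + by move=> u; rewrite /A'; case: (u == w).
  + move=> u; rewrite inE => /predU1P[->|]; last exact: hus'.
    by rewrite /strict_desc eqxx andbF.
Qed.
End TreeLaw.

(** * Expected numbers of nodes at a given depth *)

Section ExpectedCounts.
Context (R : realType) (b s s0 s1 : nat) (nu : probability (b.-tuple R) R) (n : nat).
Variable T : split_tree s s0 s1 nu n.
Hypothesis nu_simplex : nu (~` (@simplex R b)) = 0%E.
Let P := st_prob T.
Let N := @st_count _ _ _ _ _ _ _ T.
Let ve := @vec_event _ _ _ _ _ _ _ T.

Let mN v k : measurable (N v @^-1` [set k]). Proof. exact: st_count_meas. Qed.

Lemma prob_count_partition v (B : set (st_space T)) : measurable B ->
  P B = (\sum_(l <oo) P (N v @^-1` [set l] `&` B))%E.
Proof.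
move=> mB; rewrite -measure_semi_bigcup//.
- congr (P _); apply/seteqP; split=> x; last by case=> l _ [].
  by move=> Bx; exists (N v x).
- by move=> l; exact: measurableI.
- by move=> i j _ _ [x [[<- _] [<- _]]].
- by apply: bigcup_measurable => l _; exact: measurableI.
Qed.

Lemma prob_count_child w i j us A : vec_indep_count T w -> uniq us ->
  (forall u, measurable (A u)) -> (forall u, u \in us -> ~~ strict_desc u (rcons w i)) ->
  P (N (rcons w i) @^-1` [set j] `&` ve us A) =
  ((\sum_(l <oo) P (N w @^-1` [set l]) * child_mean s s0 s1 nu l j i) *
    \prod_(u <- us) nu (A u))%E.
Proof.
move=> Iw uus mA hus.
have mV : measurable (ve us A).
  by apply: (@past_measurable _ _ _ _ _ _ _ T w); exact: past_vec_event.
rewrite (@prob_count_partition w); last exact: measurableI.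
under eq_eseriesr => l _ do rewrite (count_step_event nu_simplex _ _ Iw uus mA hus).
have pfin : (\prod_(u <- us) nu (A u))%E \is a fin_num.
  by apply: prode_fin_num => u _; exact: fin_num_measure.
rewrite -(fineK pfin) muleC -nneseriesZl; last first.
  by move=> l _; rewrite mule_ge0//; exact: child_mean_ge0.
by apply: eq_eseriesr => l _; rewrite muleC.
Qed.

(** Induction along the path from the root.  The conditional law of a child count given the
    count of its parent does not involve the event on the other split vectors, which factors out. *)
Lemma vec_indep_countP v : vec_indep_count T v.
Proof.
elim/last_ind: v => [|w i IH] us A j uus mA hus; last first.
  rewrite prob_count_child//; congr (_ * _)%E.
  have := @prob_count_child w i j [::] (fun=> setT) IH isT.
  rewrite big_nil mule1 => <-//.
  by rewrite /ve /vec_event set_nil bigcap_set0 setIT.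
have indepV : P (ve us A) = (\prod_(u <- us) nu (A u))%E.
  rewrite [LHS](@st_vec_indep _ _ _ _ _ _ _ T us A uus mA).
  by apply: eq_bigr => u _; exact: st_vec_law.
have [->|jn] := eqVneq j n.
  rewrite (_ : N [::] @^-1` [set n] = setT); last first.
    by apply/seteqP; split=> // x _; exact: st_root.
  by rewrite setTI probability_setT mul1e.
rewrite (_ : N [::] @^-1` [set j] = set0); last first.
  apply/seteqP; split=> // x /= Nx; move: jn; rewrite -Nx.
  by rewrite [N _ _](@st_root _ _ _ _ _ _ _ T x) eqxx.
by rewrite set0I !measure0 mul0e.
Qed.

Lemma prob_count w i j : P (N (rcons w i) @^-1` [set j]) =
  (\sum_(l <oo) P (N w @^-1` [set l]) * child_mean s s0 s1 nu l j i)%E.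
Proof.
have := @prob_count_child w i j [::] (fun=> setT) (@vec_indep_countP w) isT.
rewrite big_nil mule1 => <-//.
by rewrite /ve /vec_event set_nil bigcap_set0 setIT.
Qed.

Hypotheses (b_gt0 : (0 < b)%N) (hs01 : (b * s1 + s0 <= s + 1)%N)
  (q_gt0 : (0 < s0 + b.-1 * s1)%N).

Lemma child_mean_small l j i : (0 < j)%N -> (l <= j)%N -> child_mean s s0 s1 nu l j i = 0%E.
Proof.
move=> j0 lj; rewrite /child_mean; case: ltnP => sl; last first.
  by rewrite (gtn_eqF j0).
apply: integral0_eq => v _; rewrite /proper_bin /bin_pmf.
case: ifP => [/andP[_ h]|_]; last by rewrite mul0r.
have : (b * s1 = s1 + b.-1 * s1)%N by rewrite -{1}(prednK b_gt0) mulSn.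
by move: h lj sl q_gt0 hs01; lia.
Qed.

(** A split removes at least one ball from each child, as [s0 + (b - 1) s1 > 0]. *)
Lemma count_bound v j : (n - size v < j)%N -> P (N v @^-1` [set j]) = 0%E.
Proof.
elim/last_ind: v j => [|w i IH] j.
  rewrite subn0 => nj; rewrite (_ : _ @^-1` _ = set0) ?measure0//.
  apply/seteqP; split=> // x /= Nx; move: nj; rewrite -Nx.
  by rewrite [N _ _](@st_root _ _ _ _ _ _ _ T x) ltnn.
rewrite size_rcons => nj; rewrite prob_count; apply: eseries0 => l _ _.
have [lj|jl] := leqP l j.
  by rewrite child_mean_small ?mule0// (leq_ltn_trans _ nj).
by rewrite [X in (X * _)%E]IH ?mul0e//; lia.
Qed.

Let p v j := fine (P (N v @^-1` [set j])).
Let pE v j : (p v j)%:E = P (N v @^-1` [set j]).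
Proof. by rewrite fineK// fin_num_measure. Qed.

Variable K : nat -> nat -> R.
Hypothesis K_mean : forall l j, (s < l)%N ->
  (\sum_(i < b) child_mean s s0 s1 nu l j i)%E = (K l j)%:E.

Lemma sum_prob_children w j : (0 < j)%N ->
  \sum_(i < b) p (rcons w i) j = \sum_(l < n.+1 | (s < l)%N) p w l * K l j.
Proof.
move=> j0; apply: EFin_inj; rewrite -!sumEFin.
under eq_bigr => i _.
  rewrite pE prob_count (@nneseries_split _ _ 0 n.+1); last first.
    by move=> l _; rewrite mule_ge0//; exact: child_mean_ge0.
  rewrite add0n [X in (_ + X)%E]eseries0 ?adde0; last first.
    by move=> l nl _; rewrite count_bound ?mul0e// (leq_ltn_trans _ nl)// leq_subr.
  rewrite big_mkord; over.
rewrite exchange_big/= [RHS]big_mkcond/=; apply: eq_bigr => l _.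
rewrite -ge0_sume_distrr; last by move=> i _; exact: child_mean_ge0.
case: ifPn => [sl|]; first by rewrite K_mean// EFinM pE.
rewrite -leqNgt => ls; rewrite big1 ?mule0// => i _.
by rewrite /child_mean ltnNge ls/= gtn_eqF.
Qed.

Fixpoint words (d : nat) : seq (seq 'I_b) :=
  if d is d'.+1 then [seq rcons w i | w <- words d', i <- enum 'I_b] else [:: [::]].

Lemma mem_words v : v \in words (size v).
Proof.
elim/last_ind: v => [|w i IH]; first by rewrite inE.
rewrite size_rcons /=; apply/allpairsP; exists (w, i); split=> //=.
by rewrite mem_enum.
Qed.

Lemma size_words d v : v \in words d -> size v = d.
Proof.
elim: d v => [|d IH] v /=; first by rewrite inE => /eqP ->.
by move=> /allpairsP[[w i] /= [/IH <- _ ->]]; rewrite size_rcons.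
Qed.

Lemma uniq_words d : uniq (words d).
Proof.
elim: d => //= d IH; apply: allpairs_uniq => //; first exact: enum_uniq.
by move=> [x i] [y j] _ _ /= /rcons_inj[-> ->].
Qed.

Let M d j := \sum_(v <- words d) p v j.

Let MS d j : (0 < j)%N -> M d.+1 j = \sum_(l < n.+1 | (s < l)%N) M d l * K l j.
Proof.
move=> j0; rewrite /M /= big_allpairs_dep/=.
under eq_bigr do rewrite big_enum/= sum_prob_children//.
rewrite exchange_big/=; apply: eq_bigr => l _.
by rewrite mulr_suml.
Qed.

Variables (k : nat) (e : nat -> R).
Hypotheses (k_gt0 : (0 < k)%N) (e0 : e 0 = 0).
Hypothesis eE : forall l, (l <= n)%N ->
  e l = (l == k)%:R + (if (s < l)%N then \sum_(j < n.+1) K l j * e j else 0).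

(** Pairing the mean counts [M d] at depth [d] with the solution [e] of the dual recursion,
    [sum_l M d l * e l] drops by [M d k] at each depth, from [e n] at depth [0] to [0] below the
    last level. *)
Lemma sum_words_prob : \sum_(d < n.+1) \sum_(v <- words d) p v k = e n.
Proof.
have big0 v j : (n - size v < j)%N -> p v j = 0.
  by move=> h; rewrite /p count_bound.
have step d : \sum_(l < n.+1) M d l * e l = M d k + \sum_(l < n.+1) M d.+1 l * e l.
  have E1 : \sum_(l < n.+1) M d l * (l == k :> nat)%:R = M d k.
    have [kn|nk] := ltnP k n.+1.
      rewrite (bigD1 (Ordinal kn))//= eqxx mulr1 big1 ?addr0// => l lk.
      rewrite (_ : (l == k :> nat) = false) ?mulr0//.
      by apply: contraNF lk => /eqP lk; apply/eqP/val_inj.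
    rewrite big1 => [|l _]; last by rewrite ltn_eqF ?mulr0// (leq_trans (ltn_ord l)).
    rewrite /M big1// => v _; apply: big0; exact: leq_ltn_trans (leq_subr _ _) nk.
  have E2 : \sum_(l < n.+1) M d.+1 l * e l =
      \sum_(l < n.+1 | (s < l)%N) M d l * \sum_(j < n.+1) K l j * e j.
    under [RHS]eq_bigr do rewrite mulr_sumr.
    rewrite exchange_big/=; apply: eq_bigr => j _.
    have [j0|j0] := posnP j; first by rewrite j0 e0 mulr0 big1// => l _; rewrite !mulr0.
    rewrite MS// mulr_suml; apply: eq_bigr => l _.
    by rewrite mulrA.
  rewrite E2 -E1 [X in _ + X]big_mkcond/= -big_split/=; apply: eq_bigr => l _.
  rewrite [in LHS]eE; last by rewrite -ltnS.
  by rewrite mulrDr; case: ifP => // _; rewrite mulr0.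
have tele D : \sum_(d < D) M d k = e n - \sum_(l < n.+1) M D l * e l.
  elim: D => [|D IH].
    rewrite big_ord0; apply/esym/eqP; rewrite subr_eq0 eq_sym; apply/eqP.
    rewrite (bigD1 ord_max)//= big1 ?addr0 => [|l ln].
      rewrite /M /words big_seq1 /p (_ : _ @^-1` _ = setT) ?probability_setT ?mul1r//.
      by apply/seteqP; split=> // x _; exact: st_root.
    rewrite /M /words big_seq1 /p (_ : _ @^-1` _ = set0) ?measure0 ?mul0r//.
    apply/seteqP; split=> // x /= Nx; move: ln.
    have := @st_root _ _ _ _ _ _ _ T x; rewrite -/(N _ _) Nx => ln.
    by rewrite -val_eqE/= ln eqxx.
  by rewrite big_ord_recr/= IH step; ring.
rewrite [LHS]tele big1 ?subr0// => l _.
have [l0|l0] := posnP l; first by rewrite l0 e0 mulr0.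
rewrite /M big_seq big1 ?mul0r// => v vD; apply: big0.
by rewrite (size_words vD); lia.
Qed.
End ExpectedCounts.

(** * The expectation of the additive functional *)

Section IntegralAlmostEverywhere.
Context d (T : measurableType d) (R : realType) (mu : {measure set T -> \bar R}).
Local Open Scope ereal_scope.
Import HBNNSimple.

(** The integral of a nonnegative function is a supremum over simple functions below it, and a
    simple function can be cut off on a null set.  The additive functional, which is [0] by
    convention on trees with infinitely many contributing nodes, agrees with a finite sum only
    outside a null event. *)
Lemma ge0_ae_le_integral_nonmeasurable (f g : T -> \bar R) :
  (forall x, 0 <= f x) -> (forall x, 0 <= g x) ->
  {ae mu, forall x, f x <= g x} -> \int[mu]_x f x <= \int[mu]_x g x.
Proof.
move=> f0 g0 [B [mB B0 fgB]].
rewrite !ge0_integralTE//; apply: ge_ereal_sup => _ [h /= hf <-].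
have mC : measurable (~` B) by exact: measurableC.
pose h' := proj_nnsfun h mC.
have h'E x : h' x = (h x * \1_(~` B) x)%R by rewrite /h' /= mindicE.
have -> : sintegral mu h = sintegral mu h'.
  rewrite -!integralT_nnsfun; apply: ge0_ae_eq_integral => //.
  - exact/measurable_EFinP.
  - exact/measurable_EFinP.
  - by move=> x _; rewrite lee_fin.
  - by move=> x _; rewrite lee_fin.
  exists B; split=> // x hx; apply: contrapT => Bx; apply: hx => _.
  by congr _%:E; rewrite h'E indicE mem_set ?mulr1.
apply: ereal_sup_ubound; exists h' => //; rewrite /mkset => x; rewrite h'E indicE.
have [Bx|Bx] := pselect (B x); first by rewrite memNset ?mulr0//; apply; exact: Bx.
rewrite mem_set// mulr1; apply: le_trans (hf x) _.
by apply: contrapT => h''; apply: Bx; exact: fgB.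
Qed.

Lemma ge0_ae_eq_integral_nonmeasurable (f g : T -> \bar R) :
  (forall x, 0 <= f x) -> (forall x, 0 <= g x) ->
  {ae mu, forall x, f x = g x} -> \int[mu]_x f x = \int[mu]_x g x.
Proof.
move=> f0 g0 fg; apply/eqP; rewrite eq_le; apply/andP; split.
- by apply: ge0_ae_le_integral_nonmeasurable => //; apply: filterS fg => x ->.
- by apply: ge0_ae_le_integral_nonmeasurable => //; apply: filterS fg => x ->.
Qed.
End IntegralAlmostEverywhere.

Section ExpectedFunctional.
Context (R : realType) (b s s0 s1 : nat) (nu : probability (b.-tuple R) R) (n : nat).
Variable T : split_tree s s0 s1 nu n.
Hypothesis nu_simplex : nu (~` (@simplex R b)) = 0%E.
Hypotheses (b_gt0 : (0 < b)%N) (hs01 : (b * s1 + s0 <= s + 1)%N)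
  (q_gt0 : (0 < s0 + b.-1 * s1)%N).
Let P := st_prob T.
Let N := @st_count _ _ _ _ _ _ _ T.

Lemma count_bound_ae : {ae P, forall x, forall v, (N v x <= n - size v)%N}.
Proof.
suff : {ae P, forall x, forall m : nat, if unpickle m is Some (v, j) then
    (n - size (v : seq 'I_b) < j)%N -> N v x != j else True}.
  apply: filterS => x h v; rewrite leqNgt; apply/negP => nv.
  have := h (pickle (v, N v x)); rewrite pickleK => /(_ nv).
  by rewrite eqxx.
apply: ae_foralln => m; case: (unpickle m) => [[v j]|]; last exact: aeW.
have [nv|vn] := ltnP (n - size v) j; last by apply: aeW => x.
exists (N v @^-1` [set j]); split.
- exact: st_count_meas.
- exact: (count_bound T nu_simplex b_gt0 hs01 q_gt0).
- by move=> x /= h; apply: contrapT => Nx; apply: h => _; apply/eqP.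
Qed.

Let nodes := flatten [seq words b d | d <- iota 0 n.+1].

Lemma mem_nodes v : (v \in nodes) = (size v <= n)%N.
Proof.
apply/flatten_mapP/idP => [[d]|vn].
  by rewrite mem_iota add0n ltnS => /andP[_ dn] /size_words ->.
by exists (size v); rewrite ?mem_words// mem_iota add0n ltnS.
Qed.

Lemma uniq_nodes : uniq nodes.
Proof.
rewrite /nodes; elim: {1}n.+1 0%N => [|m IH] i //=.
rewrite cat_uniq uniq_words IH andbT/=; apply/hasPn => v /flatten_mapP[d].
rewrite mem_iota => /andP[id _] /size_words vd; apply/negP => /size_words vi.
by move: id; rewrite -vd -vi ltnn.
Qed.

Lemma additive_functional_delta k x : (0 < k)%N -> (forall v, (N v x <= n - size v)%N) ->
  additive_functional (delta R k) (Defs.tree_of x) = \sum_(v <- nodes) \1_(N v @^-1` [set k]) x.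
Proof.
move=> k0 hx.
have fE v : delta R k (fringe (Defs.tree_of x) v) = \1_(N v @^-1` [set k]) x.
  rewrite /delta /fringe cats0 indicE /Defs.tree_of -/(N v x).
  by case: eqP => [h|h]; [rewrite mem_set|rewrite memNset].
rewrite fsbig_seq ?uniq_nodes// /additive_functional.
rewrite [LHS](eq_fsbigr (fun v => \1_(N v @^-1` [set k]) x)); last by move=> v _; exact: fE.
pose A : set (seq 'I_b) := [set v | (0 < @Defs.tree_of _ _ _ _ _ _ _ T x v)%N].
rewrite -(@fsbig_widen _ _ _ _ (A `&` [set` nodes]) A); last 2 first.
- by move=> v [].
- move=> v /= [Av h]; rewrite indicE memNset// => /= Nv; apply: h; split=> //=.
  rewrite mem_nodes; apply: ltnW; rewrite -subn_gt0; apply: leq_trans (hx v).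
  by rewrite Nv.
rewrite -(@fsbig_widen _ _ _ _ (A `&` [set` nodes]) [set` nodes])//.
- move=> v /= [vw h]; rewrite indicE memNset// => /= Nv; apply: h; split=> //=.
  by rewrite /A /= /Defs.tree_of -/(N v x) Nv.
Qed.

Lemma expectation_delta k : (0 < k)%N ->
  ('E_P[fun x => additive_functional (delta R k) (Defs.tree_of x)] =
   (\sum_(d < n.+1) \sum_(v <- words b d) fine (P (N v @^-1` [set k])))%:E)%E.
Proof.
move=> k0; rewrite unlock.
transitivity (\int[P]_x (\sum_(v <- nodes) (\1_(N v @^-1` [set k]) x)%:E))%E.
  apply: ge0_ae_eq_integral_nonmeasurable.
  - by move=> x; rewrite lee_fin /additive_functional fsumr_ge0.
  - by move=> x; apply: sume_ge0 => v _; rewrite lee_fin.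
  apply: filterS count_bound_ae => x hx.
  by rewrite additive_functional_delta// sumEFin.
have mN v : measurable (N v @^-1` [set k]) by exact: st_count_meas.
rewrite ge0_integral_sum//; last by move=> v; apply/measurable_EFinP; exact: measurable_indic.
rewrite -sumEFin /nodes big_flatten big_map/= -/(iota 0 n.+1) -{1}(subn0 n.+1).
rewrite -/(index_iota 0 n.+1) big_mkord; apply: eq_bigr => d _.
rewrite -sumEFin; apply: eq_bigr => v _.
by rewrite integral_indic// setIT fineK// fin_num_measure.
Qed.
End ExpectedFunctional.

(** * The mean recursion and its solution *)

Section KernelLaw.
Context (R : realType) (b s s0 s1 : nat) d (Om : measurableType d) (P : probability Om R).
Variables (V : {RV P >-> b.-tuple R}) (I : Om -> 'I_b).
Hypotheses (b_gt0 : (0 < b)%N) (hV : split_vector V) (hI : uniform_indep_index V I).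
Variables (a beta : R) (q : nat).
Hypotheses (qE : q.+1 = (s0 + b.-1 * s1)%N) (beta_gt0 : 0 < beta)
  (hs01 : (b * s1 + s0 <= s + 1)%N)
  (hY : beta_distributed P (fun w => tnth (V w) (I w)) a q.+1%:R)
  (hbeta : ('E_P[fun w => (\sum_(i < b) tnth (V w) i `^ beta)%R] = 1)%E).

Lemma distribution_simplex : distribution P V (~` (@simplex R b)) = 0%E.
Proof.
have mS : measurable (V @^-1` (~` (@simplex R b))).
  rewrite -[_ @^-1` _]setTI; apply: (measurable_funP V) => //.
  by apply: measurableC; exact: measurable_simplex.
suff : P (V @^-1` (~` (@simplex R b))) = 0%E by [].
have [A [mA A0 sA]] := sv_simplex hV.
by apply: (subset_measure0 mS mA _ A0) => w /= h; exact: sA.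
Qed.

(** Almost surely the split vector is in the simplex, where the truncated binomial weights
    agree with the genuine ones. *)
Lemma sum_child_mean l j : (s < l)%N ->
  (\sum_(i < b) child_mean s s0 s1 (distribution P V) l j i)%E =
  (if (s1 <= j <= l - q.+1)%N then euler_kernel a beta q (l - s1) (j - s1) else 0)%:E.
Proof.
move=> sl; pose m := (l - s0 - b * s1)%N.
have bE : (b * s1 = s1 + b.-1 * s1)%N by rewrite -{1}(prednK b_gt0) mulSn.
(* The positive part, as a coordinate can leave the unit interval on a null set. *)
pose f (t : R) : R := Num.max 0 (bin_pmf s1 m j t).
have mf : measurable_fun setT f.
  by apply: measurable_maxr => //; exact: measurable_bin_pmf.
have f0 t : 0 <= f t by rewrite le_max lexx.
have -> : (l - s1 = m + q.+1)%N by rewrite /m qE; move: bE sl hs01; lia.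
have -> : (l - q.+1 = s1 + m)%N by rewrite /m qE; move: bE sl hs01; lia.
rewrite -(@beta_binomial_kernel _ _ _ _ P V I b_gt0 hI a beta q beta_gt0 hY hbeta s1 m j f)//.
  apply: eq_bigr => i _; rewrite /child_mean sl ge0_integral_distribution//; last 2 first.
  - by apply/measurable_EFinP; exact: measurable_proper_bin.
  - by move=> v; rewrite lee_fin proper_bin_ge0.
  apply: ge0_ae_eq_integral => //.
  - apply/measurable_EFinP.
    exact: measurableT_comp (measurable_proper_bin _ _ _ _) (measurable_funP V).
  - by apply/measurable_EFinP; exact: measurableT_comp mf (measurable_split_coord V i).
  - by move=> w _; rewrite lee_fin proper_bin_ge0.
  - by move=> w _; rewrite lee_fin.
  apply: filterS (sv_simplex hV) => w hw _ /=; congr _%:E.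
  have := proper_bin_ge0 s1 m j i (V w); rewrite /proper_bin indicE mem_set// mulr1.
  by move=> h; rewrite /f max_r.
move=> t /andP[t0 t1]; rewrite /f max_r// /bin_pmf; case: ifP => // _.
by rewrite !mulr_ge0// exprn_ge0// ?subr_ge0 ltW.
Qed.

Variable k : nat.
Hypotheses (k_gt : (s1 < k)%N) (k_cases : (s < k)%N \/ (s <= s0 + b * s1)%N).

(** The solution at [n' = n - s1]; with fewer than [s1] balls, neither a node nor any of its
    descendants has [k > s1] balls. *)
Definition count_sol (l : nat) : R :=
  if (l < s1)%N then 0 else euler_sol a beta q (k - s1) (l - s1).

Let a_gt0 : 0 < a. Proof. by case: hY. Qed.

Lemma count_sol0 : count_sol 0 = 0.
Proof.
rewrite /count_sol; case: ltnP => // _; rewrite sub0n euler_sol_lt//.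
by rewrite subn_gt0.
Qed.

Let bE : (b * s1 = s1 + b.-1 * s1)%N.
Proof. by rewrite -{1}(prednK b_gt0) mulSn. Qed.

Let s1s : (s1 + q <= s)%N.
Proof. by move: bE hs01 qE; lia. Qed.

Lemma count_sol_lt j : (j < k)%N -> count_sol j = 0.
Proof.
move=> jk; rewrite /count_sol; case: ltnP => // s1j.
by rewrite euler_sol_lt// ltn_sub2r.
Qed.

(** For [l <= s] above [k] the value must vanish although no split takes place; there
    [s <= s0 + b * s1], which is the range of [euler_sol0]. *)
Lemma count_sol_rec n l : (l <= n)%N -> count_sol l = (l == k)%:R +
  (if (s < l)%N then \sum_(j < n.+1)
     (if (s1 <= j <= l - q.+1)%N then euler_kernel a beta q (l - s1) (j - s1) else 0) *
     count_sol j else 0).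
Proof.
move=> ln.
have [kl|lk] := ltnP k l; last first.
  rewrite (_ : (if _ then _ else _) = 0) ?addr0; last first.
    case: ltnP => // sl; rewrite big1// => j _; case: ifP => [/andP[_ jl]|_]; last by rewrite mul0r.
    by rewrite count_sol_lt ?mulr0//; move: s1s; lia.
  move: lk; rewrite leq_eqVlt => /predU1P[->|lk].
    by rewrite eqxx /count_sol ltnNge (ltnW k_gt)/= euler_sol_id.
  by rewrite ltn_eqF// count_sol_lt.
rewrite gtn_eqF// add0r; have s1l : (s1 < l)%N by exact: ltn_trans kl.
case: ltnP => sl; last first.
  rewrite /count_sol ltnNge (ltnW s1l)/= euler_sol0 ?(ltW beta_gt0) ?ltn_sub2r//.
  case: k_cases => h; first by move: h kl sl; lia.
  rewrite bE addnCA -qE in h; move: h k_gt kl sl; lia.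
rewrite {1}/count_sol ltnNge (ltnW s1l)/= euler_sol_rec ?(ltW beta_gt0) ?ltn_sub2r//; last first.
  by move: s1s; lia.
pose g j := (if (s1 <= j <= l - q.+1)%N then euler_kernel a beta q (l - s1) (j - s1) else 0) *
     count_sol j.
rewrite -(big_mkord xpredT g) (@big_cat_nat _ _ _ s1)//=; last by rewrite ltnW// (ltn_trans s1l).
rewrite [X in _ = X + _]big1_seq ?add0r; last first.
  by move=> j; rewrite mem_index_iota => /andP[_ /andP[_ js1]]; rewrite /g leqNgt js1 mul0r.
rewrite (@big_cat_nat _ _ _ l)//=; [|exact: ltnW|exact: ltnW].
rewrite [X in _ = _ + X]big1_seq ?addr0; last first.
  move=> j; rewrite mem_index_iota => /andP[_ /andP[lj _]].
  rewrite /g (_ : (j <= l - q.+1)%N = false) ?andbF ?mul0r//.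
  by apply/negbTE; rewrite -ltnNge; move: s1s; lia.
rewrite (_ : \sum_(s1 <= i < l) g i = \sum_(0 <= i < l - s1) g (i + s1)%N); last first.
  by rewrite -{1}(add0n s1) big_addn.
rewrite -(big_mkord xpredT
  (fun j => euler_kernel a beta q (l - s1) j * euler_sol a beta q (k - s1) j)).
apply: eq_big_nat => j /andP[_ jl]; rewrite /g leq_addl/= addnK /count_sol.
rewrite ltnNge leq_addl/= addnK.
case: leqP => // jlq; rewrite /euler_kernel bin_small ?mulr0 ?mul0r//.
by move: jl jlq s1l; lia.
Qed.
End KernelLaw.

Section Expansion.
Variable R : realType.

Lemma littleo_powR (u : nat -> R) (c be : R) :
  (fun n => u n / n%:R `^ be) @ \oo --> c ->
  (fun n => u n - c * n%:R `^ be) =o_\oo (fun n : nat => n%:R `^ be : R).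
Proof.
move=> ucvg; apply/eqoP => e e0.
move/cvgrPdist_le : ucvg => /(_ e e0) h.
near=> n; have n0 : (0 < n)%N by near: n; exact: nbhs_infty_gt.
have p0 : 0 < n%:R `^ be :> R by rewrite powR_gt0// ltr0n.
set p := n%:R `^ be in p0 *.
rewrite (_ : u n - c * p = - ((c - u n / p) * p)); last by field; rewrite gt_eqF.
rewrite normrN normrM (gtr0_norm p0) ler_pM2r// /p {p p0}.
by near: n.
Unshelve. all: by end_near. Qed.

Lemma count_sol_cvg (a be : R) (s1 q k : nat) : 0 < a -> 0 <= be <= 1 -> (s1 < k)%N ->
  count_sol s1 a be q k n / n%:R `^ be @[n --> \oo] -->
  Gamma (a + k%:R - s1%:R) / (rising_harmonic (a + be) q.+1 * Gamma (a + k%:R - s1%:R + be + 1)).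
Proof.
move=> a0 be01 sk; have := @euler_sol_cvg R a be q (k - s1) s1 a0 be01.
rewrite natrB ?(ltnW sk)// addrA (_ : a + be + _ + 1 = a + k%:R - s1%:R + be + 1); last by ring.
move=> h; rewrite -(cvg_shiftn s1)/=; apply: cvg_trans h; apply: near_eq_cvg.
by apply: nearW => n; rewrite /count_sol ltnNge leq_addl/= addnK.
Qed.
End Expansion.

Theorem corollary2p13 (R : realType) (b s s0 s1 : nat)
  (hb : (2 <= b)%N) (hs : (1 <= s)%N) (hs01 : (b * s1 + s0 <= s + 1)%N)
  (d : measure_display) (Om : measurableType d) (P : probability Om R)
  (V : {RV P >-> b.-tuple R}) (hV : split_vector V)
  (I : Om -> 'I_b) (hI : uniform_indep_index V I)
  (T : forall n : nat, split_tree s s0 s1 (distribution P V) n)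
  (beta : R) (hbeta0 : 0 < beta) (hbeta1 : beta <= 1)
  (hbeta : ('E_P[fun w => (\sum_(i < b) tnth (V w) i `^ beta)%R] = 1)%E)
  (a : R) (ha : 0 < a)
  (hbetaV : beta_distributed P (fun w => tnth (V w) (I w)) a
              (s0%:R + (b%:R - 1) * s1%:R)) :
  let mu := split_mu b P (fun w => tnth (V w) (I w)) beta in
  [/\ a <= s0%:R / (b%:R - 1) + s1%:R,
      a = s0%:R / (b%:R - 1) + s1%:R <-> beta = 1,
      mu = (digamma (a + beta + s0%:R + (b%:R - 1) * s1%:R)
            - digamma (a + beta))%:E
    & forall k : nat, (1 <= k)%N ->
        (s < k)%N \/ (s <= s0 + b * s1)%N /\ (s1 < k)%N ->
        is_varpi T beta (delta R k)
          (Gamma (a + k%:R - s1%:R)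
           / (fine mu * Gamma (a + k%:R - s1%:R + beta + 1)))].
Proof.
move=> mu; have b0 : (0 < b)%N by exact: ltn_trans hb.
have b1 : 0 < b%:R - 1 :> R by rewrite subr_gt0 ltr1n.
have qR : s0%:R + (b%:R - 1) * s1%:R = (s0 + b.-1 * s1)%:R :> R.
  by rewrite natrD natrM -subn1 natrB.
have q0 : (0 < s0 + b.-1 * s1)%N.
  by case: (hbetaV) => _; rewrite qR ltr0n.
pose q := (s0 + b.-1 * s1).-1; have qE : q.+1 = (s0 + b.-1 * s1)%N by rewrite prednK.
rewrite -qE in qR; rewrite qR in hbetaV.
have muE : mu = (rising_harmonic (a + beta) q.+1)%:E by exact: split_mu_harm hbetaV hbeta.
have [ab abE] := malthus_bound b0 hI hbeta0 hbetaV hbeta hbeta1.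
have boundE : a = s0%:R / (b%:R - 1) + s1%:R <-> b%:R * a = a + q.+1%:R.
  rewrite -qR; split=> [->|h]; first by field; rewrite gt_eqF.
  apply: (mulfI (lt0r_neq0 b1)); rewrite mulrBl h mul1r addrAC subrr add0r.
  by field; rewrite gt_eqF.
split.
- rewrite -(ler_pM2l b1) (_ : _ * (_ + s1%:R) = q.+1%:R); last first.
    by rewrite -qR; field; rewrite gt_eqF.
  by rewrite mulrBl mul1r lerBlDl.
- by split=> [/boundE/abE|/abE/boundE].
- by rewrite muE -addrA qR digamma_addn// addr_gt0.
move=> k k0 hk.
have bE : (b * s1 = s1 + b.-1 * s1)%N by rewrite -{1}(prednK b0) mulSn.
have sk : (s1 < k)%N by case: hk => [h|[]//]; move: h bE hs01 q0; lia.
have k_cases : (s < k)%N \/ (s <= s0 + b * s1)%N by case: hk => [|[]]; [left|right].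
pose e := count_sol s1 a beta q k.
exists (fun n => e n - (Gamma (a + k%:R - s1%:R)
  / (fine mu * Gamma (a + k%:R - s1%:R + beta + 1))) * n%:R `^ beta); split.
  move=> n _; rewrite subrKC.
  have nu0 := distribution_simplex hV.
  rewrite [LHS](expectation_delta (T n) nu0 b0 hs01 q0 k0); congr _%:E.
  have K_mean l j := sum_child_mean b0 hV hI qE hbeta0 hs01 hbetaV hbeta (l := l) j.
  have e0 : e 0 = 0 by exact: count_sol0.
  have eE l : (l <= n)%N -> _ := fun ln => count_sol_rec b0 qE hbeta0 hs01 hbetaV sk k_cases ln.
  exact: (sum_words_prob (T n) nu0 b0 hs01 q0 K_mean k0 e0 eE).
apply: littleo_powR; rewrite muE; apply: count_sol_cvg => //.
by rewrite ltW.
Qed.
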